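(* Let $q$ be a prime power with $q\equiv 1\pmod{20}$. Fix a primitive root $\alpha$ of $\mathbb{F}_q$ and set $\beta=\alpha^{(q-1)/5}$. Let $\chi$ be the quadratic residue character of $\mathbb{F}_q$. The following statements are equivalent: (i) $(q,5)$ gives a $3$-design; (ii) $(q,10)$ gives a $3$-design; (iii) $\chi(1+\beta)=-1$; (iv) there exists $\theta\in\mathbb{F}_q^\times$ such that $\chi(\theta)=-1$ and $\theta^2-4\theta-1=0$; (v) $5\notin\langle\alpha^4\rangle$ (i.e. the element $5=5\cdot 1\in\mathbb{F}_q$ is not a fourth power in $\mathbb{F}_q^\times$). Moreover, if $q=p$ is a prime, then each of the following conditions is also equivalent to each of (i)–(v): (vi) there is no $(x,y)\in\mathbb{Z}^2$ with $p=x^2+20y^2$; (vii) there is no $(x,y)\in\mathbb{Z}^2$ with $p=x^2+100y^2$.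
   Context: Let $q$ be a power of an odd prime. The group $\mathrm{PSL}(2,q)$ acts on the projective line $\mathrm{PG}(1,q)=\mathbb{F}_q\cup\{\infty\}$ by linear fractional transformations $z\mapsto (az+b)/(cz+d)$, where $a,b,c,d\in\mathbb{F}_q$ with $ad-bc$ a nonzero square (matrices taken modulo $\pm I$). A $k$-subset $B$ of $\mathrm{PG}(1,q)$ is a starter of a $3$-design if the orbit $\{gB: g\in\mathrm{PSL}(2,q)\}$ is the block set of a $3$-$(q+1,k,\lambda)$ design for some positive integer $\lambda$ (every $3$-subset of $\mathrm{PG}(1,q)$ lies in exactly $\lambda$ blocks). For $q\equiv1\pmod 4$ and a divisor $k$ of $q-1$, let $B$ be the unique subgroup of order $k$ of $\mathbb{F}_q^\times$ (equivalently $B=\langle\alpha^{(q-1)/k}\rangle$ for a primitive root $\alpha$); we say $(q,k)$ gives a $3$-design if $B$ is a starter of a $3$-design under $\mathrm{PSL}(2,q)$. The quadratic residue character $\chi:\mathbb{F}_q^\times\to\{\pm1\}$ is $\chi(a)=1$ if $a$ is a square in $\mathbb{F}_q^\times$ and $\chi(a)=-1$ otherwise. *)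

(* Defs.v *)
From HB Require Import structures.
From mathcomp Require Import all_boot all_order all_algebra.
Set Implicit Arguments. Unset Strict Implicit. Unset Printing Implicit Defensive.
Import GRing.Theory.
Local Open Scope ring_scope.

(* Projective line PG(1,q) = F ∪ {∞}, encoded as option F with None = ∞. *)

Definition lft (F : fieldType) (a b c d : F) (z : option F) : option F :=
  match z with
  | Some x => if c * x + d == 0 then None else Some ((a * x + b) / (c * x + d))
  | None => if c == 0 then None else Some (a / c)
  end.

(* (a,b,c,d) represents an element of PSL(2,q): ad - bc is a nonzero square. *)
Definition psl_mat (F : finFieldType) (g : (F * F) * (F * F)) : bool :=
  let: ((a, b), (c, d)) := g in
  (a * d - b * c != 0) && [exists y : F, y ^+ 2 == a * d - b * c].

Definition psl_act (F : finFieldType) (g : (F * F) * (F * F)) (z : option F) :=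
  let: ((a, b), (c, d)) := g in lft a b c d z.

Definition psl_orbit (F : finFieldType) (B : {set option F}) : {set {set option F}} :=
  [set psl_act g @: B | g in [pred g | psl_mat g]].

Definition starter3 (F : finFieldType) (B : {set option F}) : Prop :=
  exists lambda : nat, (0 < lambda)%N /\
    forall T : {set option F}, #|T| = 3%N ->
      #|[set X in psl_orbit B | T \subset X]| = lambda.

(* The unique subgroup of order k of F^x (k | q-1): the k-th roots of unity. *)
Definition root_subgroup (F : finFieldType) (k : nat) : {set option F} :=
  [set Some x | x in [set x : F | x ^+ k == 1]].

Definition gives_3design (F : finFieldType) (k : nat) : Prop :=
  starter3 (root_subgroup F k).

Definition qchi (F : finFieldType) (x : F) : int :=
  if x == 0 then 0 else if [exists y : F, y ^+ 2 == x] then 1 else -1.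

(* Main.v *)
Require Import Defs.
From HB Require Import structures.
From mathcomp Require Import all_boot all_order all_algebra.
From mathcomp Require Import all_fingroup cyclic pgroup sylow finfield.
From mathcomp Require Import ring zify.
Set Implicit Arguments. Unset Strict Implicit. Unset Printing Implicit Defensive.
Import GRing.Theory.
Local Open Scope ring_scope.

(** Double counting the matrices [g] with [T \subset g B] shows that [B], a set of
    finite points, is a starter iff [chi((x - y)(y - z)(z - x))] sums to [0] over
    the triples of [B]. For the fifth and tenth roots of unity this sum is a nonzero
    multiple of [1 + chi(1 + beta)]. The roots of [theta^2 - 4 theta - 1] are the
    opposites of cubes of Gaussian periods of character [chi(1 + beta)], and so is
    [sqrt 5 = beta (1 - beta)^2 (1 + beta)].

    For [q = p] prime, Thue's lemma gives [p = a^2 + b^2 = x^2 + 5 y^2], and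
    [chi(2 + sqrt 5)], [chi(sqrt 5)] are products of characters of [a], [a + 2 b],
    [x], [y], which reciprocity evaluates: every prime dividing one of them sees [p]
    as a square or as [5] times a square. *)

(** * The quadratic character *)

(** The group has two orbits on ordered triples of distinct points, separated by [chi] of the
    product of the pairwise determinants of representatives, so the number of blocks through a
    triple takes at most two values and the design condition is a single equality. Matrices are
    counted instead of group elements: every nonzero scalar matrix has a square determinant, so this
    only costs a factor [q - 1]. Since [q = 1] modulo 20, [-1] and all tenth roots of unity are
    squares, and [chi (x - y)] depends only on the ratio of the roots [x] and [y].

    For prime [p], an odd prime [l], different from 5 and [p], with [p = 5 y^2] modulo [l] satisfies
    [(l/p) = (p/l) = (5/l) = (l/5)]: a character modulo [p] becomes one modulo 5, which the
    representation of [p] determines. The obstacle is the prime 2, outside this reciprocity; it is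
    handled by [2 i = (1 + i)^2] with [i^2 = -1], and by reading [p] modulo 8 off the even
    coordinate. *)

Lemma finField_prim_root (F : finFieldType) :
  exists alpha : F, (#|F|.-1).-primitive_root alpha.
Proof.
have q1 : (0 < #|F|.-1)%N by have := finNzRing_gt1 F; case: #|F| => [|[]].
pose rs := enum [pred x : F | x != 0].
have : has (#|F|.-1).-primitive_root rs.
  apply: has_prim_root => //.
  - apply/allP => x; rewrite mem_enum inE => x0; rewrite unity_rootE.
    by rewrite -subn1 -(inj_eq (mulfI x0)) -exprS subn1 prednK ?(ltnW (finNzRing_gt1 F)) // expf_card mulr1.
  - exact: enum_uniq.
  - rewrite -cardE; have := cardC1 (0 : F).
    by move=> <-; apply: eq_leq; apply: eq_card.
by case/hasP => a _ Ha; exists a.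
Qed.

Section QuadraticCharacter.
Variables (F : finFieldType).
Implicit Types x y : F.

Lemma qchi0 : qchi (0 : F) = 0.
Proof. by rewrite /qchi eqxx. Qed.

Lemma qchi1P x : reflect (x != 0 /\ exists y, y ^+ 2 = x) (qchi x == 1).
Proof.
rewrite /qchi; case: eqVneq => [->|x0]; first by apply: (iffP idP) => // -[].
have [/existsP yx|yx] := boolP [exists y, y ^+ 2 == x].
  by apply: (iffP idP) => // _; split=> //; have [y /eqP] := yx; exists y.
apply: (iffP idP) => // -[_ [y /eqP xy]]; case/existsP: yx; by exists y.
Qed.

Lemma qchi_sqr x : x != 0 -> qchi (x ^+ 2) = 1.
Proof. by move=> x0; apply/eqP/qchi1P; rewrite expf_neq0 //; split=> //; exists x. Qed.

Lemma qchi1 : qchi (1 : F) = 1.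
Proof. by rewrite -(expr1n _ 2) qchi_sqr ?oner_eq0. Qed.

Lemma qchi_pm1 x : x != 0 -> qchi x = 1 \/ qchi x = -1.
Proof. by rewrite /qchi => /negbTE ->; case: ifP; [left | right]. Qed.

Lemma qchi_eq0 x : (qchi x == 0) = (x == 0).
Proof.
have [->|x0] := eqVneq x 0; first by rewrite qchi0 eqxx.
by case: (qchi_pm1 x0) => ->.
Qed.

Lemma qchi_sqr_eq1 x : x != 0 -> qchi x * qchi x = 1.
Proof. by move/qchi_pm1 => [] ->. Qed.

Lemma prim_root_exp (alpha : F) x :
  (#|F|.-1).-primitive_root alpha -> x != 0 -> exists n, x = alpha ^+ n.
Proof.
move=> pa x0.
have : x ^+ #|F|.-1 = 1.
  apply: (mulfI x0); rewrite -exprS prednK ?expf_card ?mulr1 //.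
  exact: ltnW (finNzRing_gt1 F).
by case/(prim_rootP pa) => i ->; exists (val i).
Qed.

Lemma prim_root_neq0 (alpha : F) : (#|F|.-1).-primitive_root alpha -> alpha != 0.
Proof.
move=> pa; apply/eqP => a0; move: (prim_expr_order pa) (prim_order_gt0 pa).
by rewrite a0 expr0n; case: (_.-1) => //= ? /eqP; rewrite eq_sym oner_eq0.
Qed.

Hypothesis oddF : odd #|F|.

(** As [q - 1] is even, the parity of an exponent of [alpha] survives reduction modulo [q - 1], so
    an odd power cannot be a square. Multiplicativity of [qchi] follows from this. *)
Lemma qchi_prim_root (alpha : F) n :
  (#|F|.-1).-primitive_root alpha -> qchi (alpha ^+ n) = (-1) ^+ n.
Proof.
move=> pa.
have an0 k : alpha ^+ k != 0 by rewrite expf_neq0 ?(prim_root_neq0 pa).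
have [on|en] := boolP (odd n); last first.
  rewrite -signr_odd (negbTE en) -[n]odd_double_half (negbTE en) add0n -mul2n mulnC exprM.
  exact: qchi_sqr.
rewrite -signr_odd on expr1.
case: (qchi_pm1 (an0 n)) => // /eqP/qchi1P[_ [y yn]].
have y0 : y != 0 by apply: contraNneq (an0 n) => y0; rewrite -yn y0 expr0n.
have [m ym] := prim_root_exp pa y0.
move/eqP: yn; rewrite ym -exprM (eq_prim_root_expr pa) => /eqP/(congr1 odd).
have e2 : odd #|F|.-1 = false by have := finNzRing_gt1 F; move: oddF; case: #|F| => // k /= /negbTE.
by rewrite !odd_mod // on oddM andbF.
Qed.

Lemma qchiM x y : qchi (x * y) = qchi x * qchi y.
Proof.
have [->|x0] := eqVneq x 0; first by rewrite mul0r qchi0 mul0r.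
have [->|y0] := eqVneq y 0; first by rewrite mulr0 qchi0 mulr0.
have [alpha pa] := finField_prim_root F.
have [m ->] := prim_root_exp pa x0; have [n ->] := prim_root_exp pa y0.
by rewrite -exprD !(qchi_prim_root _ pa) exprD.
Qed.

Lemma qchi_sqrM x y : x != 0 -> qchi (x ^+ 2 * y) = qchi y.
Proof. by move=> x0; rewrite qchiM qchi_sqr // mul1r. Qed.

Lemma qchiX x n : qchi (x ^+ n) = qchi x ^+ n.
Proof. by elim: n => [|n IH]; rewrite ?qchi1 // !exprS qchiM IH. Qed.

(** If 2 were 0, then 1 would be the only square root of 1, so [alpha ^+ ((q - 1) / 2)] would be 1,
    against the order of [alpha]. *)
Lemma two_neq0 : 2%:R != 0 :> F.
Proof.
have [alpha pa] := finField_prim_root F.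
have := @qchi_prim_root alpha 1 pa; rewrite expr1 => qa.
apply/eqP => two0.
have m1 : -1 = 1 :> F by apply/eqP; rewrite -subr_eq0 -opprD -mulr2n two0 oppr0.
have := prim_expr_order pa; have : odd #|F|.-1 = false.
  by have := finNzRing_gt1 F; move: oddF; case: #|F| => // k /= /negbTE.
move=> /negbT; rewrite -dvdn2 => /dvdnP[k q2]; rewrite q2 exprM => /eqP.
rewrite sqrf_eq1 m1 orbb -(prim_order_dvd pa) q2 => /dvdn_leq.
have : (0 < #|F|.-1)%N := prim_order_gt0 pa.
by rewrite q2; case: k {q2} => // k _ /(_ isT); lia.
Qed.

End QuadraticCharacter.

(** * Starters of 3-designs and character sums *)

Section ProjectiveLine.
Variable F : fieldType.
Implicit Types (p : option F) (u v w : F * F) (g h : (F * F) * (F * F)).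

(** Homogeneous coordinates replace the case analysis of [lft] at infinity by a linear map, so that
    equalities of points become polynomial identities. *)
Definition hvec p : F * F := if p is Some x then (x, 1) else (1, 0).
Definition hpoint v : option F := if v.2 == 0 then None else Some (v.1 / v.2).
Definition cross u v : F := u.1 * v.2 - u.2 * v.1.
Definition mxact g v : F * F :=
  let: ((a, b), (c, d)) := g in (a * v.1 + b * v.2, c * v.1 + d * v.2).
Definition mxdet g : F := let: ((a, b), (c, d)) := g in a * d - b * c.
Definition mxmul g h : (F * F) * (F * F) :=
  let: ((a, b), (c, d)) := g in let: ((a', b'), (c', d')) := h in
  ((a * a' + b * c', a * b' + b * d'), (c * a' + d * c', c * b' + d * d')).
Definition mxadj g : (F * F) * (F * F) :=
  let: ((a, b), (c, d)) := g in ((d, - b), (- c, a)).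
Definition mxscale (s : F) g : (F * F) * (F * F) :=
  let: ((a, b), (c, d)) := g in ((s * a, s * b), (s * c, s * d)).

Lemma hvecK p : hpoint (hvec p) = p.
Proof. by case: p => [x|]; rewrite /hpoint /= ?eqxx // oner_eq0 divr1. Qed.

Lemma hvec_neq0 p : hvec p != (0, 0).
Proof. by case: p => [x|]; rewrite /= xpair_eqE oner_eq0 // andbF. Qed.

Lemma hpointK v : v != (0, 0) ->
  exists2 s, s != 0 & v = (s * (hvec (hpoint v)).1, s * (hvec (hpoint v)).2).
Proof.
case: v => x y; rewrite /hpoint xpair_eqE /=.
have [->|y0] := eqVneq y 0; rewrite ?andbT => x0.
  by exists x; rewrite //= mulr1 mulr0.
by exists y; rewrite //= mulr1 mulrC divfK.
Qed.

Lemma hpoint_scale s v : s != 0 -> hpoint (s * v.1, s * v.2) = hpoint v.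
Proof.
move=> s0; rewrite /hpoint /= mulf_eq0 (negbTE s0) /=; case: eqP => // /eqP y0.
by rewrite invfM mulrACA divff // mul1r.
Qed.

Lemma cross_eq0 v p : v != (0, 0) -> (cross v (hvec p) == 0) = (hpoint v == p).
Proof.
case: v => x y; rewrite /cross /hpoint xpair_eqE /=.
case: p => [z|] /=; have [->|y0] := eqVneq y 0; rewrite ?andbT => x0;
  rewrite ?mulr0 ?mul0r ?mulr1 ?subr0 ?sub0r ?oppr_eq0 ?(negbTE x0) ?eqxx ?(negbTE y0) //.
rewrite subr_eq0; apply/eqP/eqP => [->|[<-]]; last by rewrite mulrC divfK.
by rewrite mulrC mulKf.
Qed.

Lemma cross_hvec_eq0 p p' : (cross (hvec p) (hvec p') == 0) = (p == p').
Proof. by rewrite cross_eq0 ?hvec_neq0 // hvecK. Qed.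

Lemma mxact_neq0 g v : mxdet g != 0 -> v != (0, 0) -> mxact g v != (0, 0).
Proof.
case: g => [[a b] [c d]]; case: v => x y /= D0; apply: contraNN => /eqP[e1 e2].
have dx : (a * d - b * c) * x = d * (a * x + b * y) - b * (c * x + d * y) by ring.
have dy : (a * d - b * c) * y = a * (c * x + d * y) - c * (a * x + b * y) by ring.
by move/eqP: dx; move/eqP: dy; rewrite e1 e2 !mulr0 subr0 !mulf_eq0 (negbTE D0) /= => /eqP-> /eqP->.
Qed.

Lemma mxdetM g h : mxdet (mxmul g h) = mxdet g * mxdet h.
Proof. by case: g => [[a b] [c d]]; case: h => [[a' b'] [c' d']] /=; ring. Qed.

Lemma mxdet_adj g : mxdet (mxadj g) = mxdet g.
Proof. by case: g => [[a b] [c d]] /=; ring. Qed.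

Lemma mxdet_scale s g : mxdet (mxscale s g) = s ^+ 2 * mxdet g.
Proof. by case: g => [[a b] [c d]] /=; ring. Qed.

Lemma mxadj_mul g h : mxmul (mxadj g) (mxmul g h) = mxscale (mxdet g) h.
Proof.
case: g => [[a b] [c d]]; case: h => [[a' b'] [c' d']] /=.
by congr (_, _, (_, _)); ring.
Qed.

Lemma mxmul_adj g h : mxmul g (mxmul (mxadj g) h) = mxscale (mxdet g) h.
Proof.
case: g => [[a b] [c d]]; case: h => [[a' b'] [c' d']] /=.
by congr (_, _, (_, _)); ring.
Qed.

Lemma mxscale_inj s : s != 0 -> injective (mxscale s).
Proof.
move=> s0 [[a b] [c d]] [[a' b'] [c' d']] /= [] /(mulfI s0)-> /(mulfI s0)->.
by move=> /(mulfI s0)-> /(mulfI s0)->.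
Qed.

Lemma cross_mxact g u v : cross (mxact g u) (mxact g v) = mxdet g * cross u v.
Proof. by case: g => [[a b] [c d]]; rewrite /cross /=; ring. Qed.
End ProjectiveLine.

Section Action.
Variable F : finFieldType.
Implicit Types (p : option F) (g h : (F * F) * (F * F)).

Lemma psl_actE g p : psl_act g p = hpoint (mxact g (hvec p)).
Proof.
case: g => [[a b] [c d]]; case: p => [x|]; rewrite /psl_act /lft /hpoint /=.
  by rewrite !mulr1.
by rewrite !mulr1 !mulr0 !addr0.
Qed.

Lemma psl_act_eq g p p' :
  mxdet g != 0 -> (psl_act g p == p') = (cross (mxact g (hvec p)) (hvec p') == 0).
Proof. by move=> D0; rewrite psl_actE cross_eq0 // mxact_neq0 ?hvec_neq0. Qed.

Lemma psl_actM g h p :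
  mxdet h != 0 -> psl_act (mxmul g h) p = psl_act g (psl_act h p).
Proof.
move=> D0; rewrite !psl_actE.
have [s s0] := hpointK (mxact_neq0 D0 (hvec_neq0 p)).
move: (hvec (hpoint _)) => w hw; rewrite -(hpoint_scale (mxact g w) s0).
congr hpoint; move: hw; case: g => [[a b] [c d]]; case: h {D0} => [[a' b'] [c' d']] /= [e1 e2].
by congr (_, _); rewrite mulrDr ![s * (_ * _)]mulrCA -e1 -e2; ring.
Qed.

Lemma psl_act_scale s g p : s != 0 -> psl_act (mxscale s g) p = psl_act g p.
Proof.
move=> s0; rewrite !psl_actE -[RHS](hpoint_scale _ s0); congr hpoint.
by case: g => [[a b] [c d]] /=; congr (_, _); ring.
Qed.

Lemma psl_act_adjK g p : mxdet g != 0 -> psl_act (mxadj g) (psl_act g p) = p.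
Proof.
move=> D0; rewrite -psl_actM // psl_actE -[RHS]hvecK -[RHS](hpoint_scale _ D0).
by congr hpoint; case: g {D0} => [[a b] [c d]]; case: p => [x|] /=; congr (_, _); ring.
Qed.

Lemma psl_act_inj g : mxdet g != 0 -> injective (psl_act g).
Proof. by move=> D0; apply: can_inj (fun p => psl_act_adjK p D0). Qed.

Lemma psl_matE g : psl_mat g = (qchi (mxdet g) == 1).
Proof.
case: g => [[a b] [c d]]; rewrite /psl_mat; apply/andP/qchi1P => -[D0 H]; split=> //.
  by have /existsP[y /eqP] := H; exists y.
by apply/existsP; have [y Hy] := H; exists y; apply/eqP.
Qed.

Lemma psl_mat_det g : psl_mat g -> mxdet g != 0.
Proof. by rewrite psl_matE => /qchi1P[]. Qed.

Lemma psl_actA g h (B : {set option F}) :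
  psl_mat h -> psl_act (mxmul g h) @: B = psl_act g @: (psl_act h @: B).
Proof.
by move=> /psl_mat_det D0; rewrite -imset_comp; apply: eq_imset => p /=; rewrite psl_actM.
Qed.

(** Each vector occurs in two of the three factors, so another choice of representatives changes
    [tri] by a square: its character depends only on the points. *)
Definition tri (a b c : option F) : F :=
  cross (hvec a) (hvec b) * cross (hvec b) (hvec c) * cross (hvec c) (hvec a).

Lemma tri_neq0 a b c : (tri a b c != 0) = [&& a != b, b != c & c != a].
Proof. by rewrite /tri !mulf_eq0 !negb_or !cross_hvec_eq0 andbA. Qed.

Lemma tri_Some x y z : tri (Some x) (Some y) (Some z) = (x - y) * (y - z) * (z - x).
Proof. by rewrite /tri /cross /= !mulr1 !mul1r. Qed.

Hypothesis oddF : odd #|F|.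

Lemma psl_matM g h : psl_mat g -> psl_mat h -> psl_mat (mxmul g h).
Proof. by rewrite !psl_matE mxdetM qchiM // => /eqP-> /eqP->. Qed.

Lemma psl_mat_adj g : psl_mat (mxadj g) = psl_mat g.
Proof. by rewrite !psl_matE mxdet_adj. Qed.

Lemma psl_mat_scale s g : s != 0 -> psl_mat (mxscale s g) = psl_mat g.
Proof. by move=> s0; rewrite !psl_matE mxdet_scale qchiM // qchi_sqr // mul1r. Qed.

(* [det g]^3 times the invariant of a triple is a square times the invariant of its image. *)
Lemma qchi_tri g a b c : mxdet g != 0 ->
  qchi (tri (psl_act g a) (psl_act g b) (psl_act g c)) = qchi (mxdet g) * qchi (tri a b c).
Proof.
move=> D0; rewrite !psl_actE /tri.
have K p := hpointK (mxact_neq0 D0 (hvec_neq0 p)).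
have [s s0 es] := K a; have [t t0 et] := K b; have [r r0 er] := K c.
move: es et er; do 3 move: (hvec (hpoint _)).
move=> wc wb wa ea eb ec.
have := cross_mxact g (hvec a) (hvec b); have := cross_mxact g (hvec b) (hvec c).
have := cross_mxact g (hvec c) (hvec a); rewrite ea eb ec => e1 e2 e3.
have E : (s * t * r) ^+ 2 * (cross wa wb * cross wb wc * cross wc wa) =
   mxdet g ^+ 2 * mxdet g * (cross (hvec a) (hvec b) * cross (hvec b) (hvec c) * cross (hvec c) (hvec a)).
  transitivity ((mxdet g * cross (hvec a) (hvec b)) * (mxdet g * cross (hvec b) (hvec c))
    * (mxdet g * cross (hvec c) (hvec a))); last by ring.
  by rewrite -e1 -e2 -e3 /cross /=; ring.
have /(congr1 (@qchi F)) := E.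
by rewrite qchi_sqrM ?mulf_neq0 // -[mxdet g ^+ 2 * _ * _]mulrA qchi_sqrM // [qchi (mxdet g * _)]qchiM.
Qed.
End Action.

(** * Counting the matrices that carry the base block over a given triple *)

Section DoubleCounting.
Variable F : finFieldType.
Hypothesis oddF : odd #|F|.
Implicit Types (g h : (F * F) * (F * F)) (A : {set F}) (B T : {set option F}).

(** Finite fixed points are roots of [a x + b - (c x + d) x], of degree at most two, so three of
    them annihilate its coefficients. The weights [y - z], [z - x], [x - y] are those of a second
    divided difference and isolate [c]. *)
Lemma scalar_of_fix3 g (x y z : F) : mxdet g != 0 -> x != y -> y != z -> z != x ->
  psl_act g (Some x) = Some x -> psl_act g (Some y) = Some y ->
  psl_act g (Some z) = Some z -> exists s, g = mxscale s ((1, 0), (0, 1)).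
Proof.
move=> D0 xy yz zx /eqP ex /eqP ey /eqP ez; move: ex ey ez.
rewrite !psl_act_eq //; case: g {D0} => [[a b] [c d]]; rewrite /cross /=.
rewrite !mulr1 => /eqP ex /eqP ey /eqP ez.
have c0 : c = 0.
  have /eqP : c * ((x - y) * (y - z) * (z - x)) = 0.
    transitivity ((y - z) * (a * x + b - (c * x + d) * x) +
      (z - x) * (a * y + b - (c * y + d) * y) + (x - y) * (a * z + b - (c * z + d) * z)).
      by ring.
    by rewrite ex ey ez; ring.
  by rewrite !mulf_eq0 !subr_eq0 (negbTE xy) (negbTE yz) (negbTE zx) !orbF => /eqP.
rewrite {}c0 in ex ey ez *.
have ad : a = d.
  have /eqP : (a - d) * (x - y) = 0.
    by transitivity ((a * x + b - (0 * x + d) * x) - (a * y + b - (0 * y + d) * y));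
       [ring | rewrite ex ey subrr].
  by rewrite mulf_eq0 [x - y == 0]subr_eq0 (negbTE xy) orbF subr_eq0 => /eqP.
have b0 : b = 0 by rewrite -{}ex {}ad; ring.
by exists d; rewrite ad b0; congr (_, _, (_, _)); ring.
Qed.

(** Matrix of [v |-> p (cross v u2) w1 + r (cross u1 v) w2], which sends [u1] and [u2] to multiples
    of [w1] and [w2]. By Cramer's rule, [cross w3 w2] and [cross w1 w3] are, up to a common factor,
    the coordinates of [w3] on [w1] and [w2]; the other factors of [p] and [r] make the image of
    [u3] a multiple of [w3]. *)
Definition mx_of_triples (u1 u2 u3 w1 w2 w3 : F * F) : (F * F) * (F * F) :=
  let p := cross w3 w2 * cross u1 u3 in let r := cross w1 w3 * cross u3 u2 in
  ((p * u2.2 * w1.1 - r * u1.2 * w2.1, r * u1.1 * w2.1 - p * u2.1 * w1.1),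
   (p * u2.2 * w1.2 - r * u1.2 * w2.2, r * u1.1 * w2.2 - p * u2.1 * w1.2)).

Lemma exists_mx_triple (a b c a' b' c' : option F) :
  tri a b c != 0 -> tri a' b' c' != 0 ->
  exists g, [/\ mxdet g != 0, psl_act g a = a', psl_act g b = b' & psl_act g c = c'].
Proof.
rewrite !tri_neq0 => /and3P[ab bc ca] /and3P[ab' bc' ca'].
pose g := mx_of_triples (hvec a) (hvec b) (hvec c) (hvec a') (hvec b') (hvec c').
have D0 : mxdet g != 0.
  suff -> : mxdet g = cross (hvec c') (hvec b') * cross (hvec a) (hvec c) *
    (cross (hvec a') (hvec c') * cross (hvec c) (hvec b)) *
    (cross (hvec a) (hvec b) * cross (hvec a') (hvec b')).
    by rewrite !mulf_neq0 // cross_hvec_eq0 // eq_sym.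
  by rewrite /g /mx_of_triples /cross /=; ring.
exists g; split=> //; apply/eqP; rewrite psl_act_eq //; apply/eqP;
  by rewrite /g /mx_of_triples /cross /=; ring.
Qed.

(** The matrices with prescribed images of three points are the nonzero multiples of a single [g0].
    They share the character of their determinant, and [qchi_tri] makes it 1 exactly when both
    triples have the same character. *)
Lemma card_mx_triple (x y z : F) (a b c : option F) :
  x != y -> y != z -> z != x -> a != b -> b != c -> c != a ->
  #|[set g | psl_mat g & [&& psl_act g (Some x) == a, psl_act g (Some y) == b
                           & psl_act g (Some z) == c]]|
  = if qchi ((x - y) * (y - z) * (z - x)) == qchi (tri a b c) then #|F|.-1 else 0%N.
Proof.
move=> xy yz zx ab bc ca; rewrite -tri_Some.
have t0 : tri (Some x) (Some y) (Some z) != 0.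
  by rewrite tri_Some !mulf_neq0 // subr_eq0.
have t0' : tri a b c != 0 by rewrite tri_neq0 ab bc ca.
have [g0 [D0 gx gy gz]] := exists_mx_triple t0 t0'.
have qg := qchi_tri oddF (Some x) (Some y) (Some z) D0; rewrite gx gy gz in qg.
case: eqP => [qq|qq]; last first.
  apply/eqP; rewrite cards_eq0; apply/eqP/setP => g; rewrite !inE.
  apply/negP => /andP[Mg /and3P[/eqP ex /eqP ey /eqP ez]]; apply: qq.
  rewrite -ex -ey -ez qchi_tri ?psl_mat_det //.
  by move: Mg; rewrite psl_matE => /eqP->; rewrite mul1r.
have M0 : psl_mat g0.
  have n0 : qchi (tri (Some x) (Some y) (Some z)) != 0 by rewrite qchi_eq0.
  by rewrite psl_matE; apply/eqP/(mulIf n0); rewrite mul1r -qg qq.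
have inj : injective (fun s => mxscale s g0).
  move=> s t; case: g0 D0 {gx gy gz qg M0} => [[a0 b0] [c0 d0]] /= D0 [ea eb _ _].
  apply/eqP; rewrite -subr_eq0 -(mulIr_eq0 _ (mulIf D0)); apply/eqP.
  transitivity ((s * a0 - t * a0) * d0 - (s * b0 - t * b0) * c0); first by ring.
  by rewrite ea eb; ring.
rewrite -(cardC1 (0 : F)) -(card_imset _ inj); apply: eq_card => h; rewrite inE.
apply/andP/imsetP => [[Mh /and3P[/eqP hx /eqP hy /eqP hz]]|[s]]; last first.
  rewrite inE => s0 ->; rewrite psl_mat_scale // M0; split=> //.
  by rewrite !psl_act_scale // gx gy gz !eqxx.
have Dh := psl_mat_det Mh.
have [||||s es] := @scalar_of_fix3 (mxmul (mxadj g0) h) x y z _ xy yz zx.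
- by rewrite mxdetM mxdet_adj mulf_neq0.
- by rewrite psl_actM // hx -gx psl_act_adjK.
- by rewrite psl_actM // hy -gy psl_act_adjK.
- by rewrite psl_actM // hz -gz psl_act_adjK.
have eh : h = mxscale (s / mxdet g0) g0.
  apply: (mxscale_inj D0); rewrite -mxmul_adj es.
  case: (g0) D0 => [[a0 b0] [c0 d0]] /= D0.
  by congr (_, _, (_, _)); field.
exists (s / mxdet g0) => //; rewrite inE; apply: contraNneq Dh => s0.
by rewrite eh s0 mxdet_scale expr0n mul0r.
Qed.

Definition triples A : {set F * F * F} :=
  [set u | [&& u.1.1 \in A, u.1.2 \in A & u.2 \in A]].

Definition disc (u : F * F * F) : F := (u.1.1 - u.1.2) * (u.1.2 - u.2) * (u.2 - u.1.1).

Definition ntriples A (e : int) := #|[set u in triples A | qchi (disc u) == e]|.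

Lemma mem_psl_imset A g p : p \in psl_act g @: [set Some x | x in A] ->
  exists2 x, x \in A & psl_act g (Some x) = p.
Proof. by move=> /imsetP[_ /imsetP[x xA ->] ->]; exists x. Qed.

(** Since [g] acts injectively, it covers the three points if and only if exactly one ordered triple
    of [A] is sent to [(a, b, c)]. Exchanging the sums over [g] and over triples leaves the count of
    [card_mx_triple]; degenerate triples contribute nothing. *)
Lemma card_cover A (a b c : option F) : a != b -> b != c -> c != a ->
  #|[set g | psl_mat g & [set a; b; c] \subset psl_act g @: [set Some x | x in A]]|
  = (ntriples A (qchi (tri a b c)) * #|F|.-1)%N.
Proof.
move=> ab bc ca.
have t0 : tri a b c != 0 by rewrite tri_neq0 ab bc ca.
pose m g (u : F * F * F) := [&& psl_act g (Some u.1.1) == a,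
  psl_act g (Some u.1.2) == b & psl_act g (Some u.2) == c].
have cov g : psl_mat g ->
    (([set a; b; c] \subset psl_act g @: [set Some x | x in A]) : nat)
     = (\sum_(u in triples A) m g u)%N.
  move=> Mg; have ginj := psl_act_inj (psl_mat_det Mg).
  case: (boolP (_ \subset _)) => [|H].
    rewrite !subUset !sub1set => /andP[/andP[]].
    move=> /mem_psl_imset[x xA gx] /mem_psl_imset[y yA gy] /mem_psl_imset[z zA gz].
    rewrite (bigD1 (x, y, z)) ?inE /= ?xA ?yA ?zA //= /m /= gx gy gz !eqxx big1 //.
    move=> [[x' y'] z'] /andP[_ /= ne]; apply/eqP; rewrite eqb0; apply: contraNN ne.
    rewrite -gx -gy -gz !(inj_eq ginj) => /and3P[/eqP[->] /eqP[->] /eqP[->]].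
    exact: eqxx.
  rewrite big1 // => -[[x y] z]; rewrite inE /= => /and3P[xA yA zA].
  apply/eqP; rewrite eqb0; apply: contraNN H => /and3P[/= /eqP<- /eqP<- /eqP<-].
  by rewrite !subUset !sub1set !imset_f.
transitivity (\sum_(g | psl_mat g) \sum_(u in triples A) m g u)%N.
  rewrite -(eq_bigr _ cov) -sum1_card -big_mkcondr /=.
  by apply: eq_bigl => g; rewrite inE.
rewrite exchange_big /= -sum_nat_const /ntriples.
rewrite (eq_bigl (fun u => (u \in triples A) && (qchi (disc u) == qchi (tri a b c))));
  last by move=> u; rewrite inE.
rewrite big_mkcondr /=; apply: eq_bigr => -[[x y] z] _.
have -> : (\sum_(g | psl_mat g) m g (x, y, z))%N =
   #|[set g | psl_mat g & m g (x, y, z)]|.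
  by rewrite -sum1_card -big_mkcondr /=; apply: eq_bigl => g; rewrite inE.
rewrite /disc /m /=.
case: (boolP ((x - y) * (y - z) * (z - x) == 0)) => [d0|].
  rewrite (eqP d0) qchi0 eq_sym qchi_eq0 (negbTE t0).
  apply/eqP; rewrite cards_eq0; apply/eqP/setP => g; rewrite !inE; apply/negP.
  case/andP=> Mg /and3P[/eqP ex /eqP ey /eqP ez]; move: d0 ab bc ca.
  rewrite -ex -ey -ez !mulf_eq0 !subr_eq0 => /orP[/orP[]|] /eqP->;
   by rewrite eqxx ?andbF.
rewrite !mulf_eq0 !subr_eq0 !negb_or => /andP[/andP[xy yz] zx].
exact: card_mx_triple.
Qed.

Definition stab_size B := #|[set g | psl_mat g & psl_act g @: B == B]|.

Lemma psl_imset_adjK g B : psl_mat g -> psl_act (mxadj g) @: (psl_act g @: B) = B.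
Proof.
move=> Mg; rewrite -imset_comp -[RHS]imset_id; apply: eq_imset => p /=.
exact: psl_act_adjK (psl_mat_det Mg).
Qed.

Lemma mxmul_inj g : mxdet g != 0 -> injective (mxmul g).
Proof.
by move=> D0 h h' e; apply: (mxscale_inj D0); rewrite -!mxadj_mul e.
Qed.

(** This is the coset argument of orbit-stabilizer. As [mxadj g0] inverts [g0] only up to a scalar,
    two injections in opposite directions stand in for a bijection. *)
Lemma card_fiber_orbit B X : X \in psl_orbit B ->
  #|[set g | psl_mat g & psl_act g @: B == X]| = stab_size B.
Proof.
case/imsetP => g0; rewrite inE => M0 ->; have D0 := psl_mat_det M0.
apply/eqP; rewrite eqn_leq; apply/andP; split.
  have D0' : mxdet (mxadj g0) != 0 by rewrite mxdet_adj.
  rewrite -(card_imset _ (mxmul_inj D0')); apply: subset_leq_card; apply/subsetP => h /imsetP[g].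
  rewrite !inE => /andP[Mg /eqP gB] ->.
  by rewrite psl_matM ?psl_mat_adj //= psl_actA // gB psl_imset_adjK.
rewrite /stab_size -(card_imset _ (mxmul_inj D0)); apply: subset_leq_card; apply/subsetP => h /imsetP[g].
rewrite !inE => /andP[Mg /eqP gB] ->.
by rewrite psl_matM //= psl_actA // gB.
Qed.

Lemma stab_size_gt0 B : (0 < stab_size B)%N.
Proof.
rewrite card_gt0; apply/set0Pn; exists ((1, 0), (0, 1)); rewrite inE psl_matE /=.
rewrite mulr1 mulr0 subr0 qchi1 eqxx /=; apply/eqP; rewrite -[RHS]imset_id.
apply: eq_imset => p; rewrite psl_actE -[RHS]hvecK.
by case: p => [x|] /=; congr hpoint; congr (_, _); ring.
Qed.

Lemma card_cover_orbit B T :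
  #|[set g | psl_mat g & T \subset psl_act g @: B]|
  = (#|[set X in psl_orbit B | T \subset X]| * stab_size B)%N.
Proof.
rewrite -sum1_card -sum_nat_const.
rewrite (partition_big (fun g => psl_act g @: B) (mem [set X in psl_orbit B | T \subset X])) /=.
  apply: eq_bigr => X; rewrite inE => /andP[OX TX]; rewrite -(card_fiber_orbit OX) -sum1_card.
  by apply: eq_bigl => g; rewrite !inE; case: eqP => [->|]; rewrite ?TX ?andbT ?andbF.
by move=> g; rewrite !inE => /andP[Mg ->]; rewrite andbT; apply: imset_f; rewrite inE.
Qed.

Definition charsum A : int := \sum_(u in triples A) qchi (disc u).

Lemma charsumE A : charsum A = (ntriples A 1)%:Z - (ntriples A (-1))%:Z.
Proof.
have nE e : (ntriples A e)%:Z = \sum_(u in triples A) (qchi (disc u) == e)%:R.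
  rewrite /ntriples -sum1_card (eq_bigl (fun u => (u \in triples A) && (qchi (disc u) == e)));
    last by move=> u; rewrite inE.
  rewrite big_mkcondr -natz natr_sum; apply: eq_bigr => u _; by case: ifP.
rewrite !nE -sumrB; apply: eq_bigr => u _.
have [->|d0] := eqVneq (disc u) 0; first by rewrite qchi0.
by case: (qchi_pm1 d0) => ->.
Qed.

Lemma tri_inf0 (e : F) : tri None (Some 0) (Some e) = e.
Proof. by rewrite /tri /cross /=; ring. Qed.

Lemma cards3 (a b c : option F) : a != b -> b != c -> c != a -> #|[set a; b; c]| = 3%N.
Proof.
by move=> ab bc ca; rewrite setUC cardsU1 !inE cards2 ab (negbTE ca) eq_sym (negbTE bc).
Qed.

Lemma cards3P (T : finType) (X : {set T}) : (2 < #|X|)%N ->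
  exists a b c, [/\ [set a; b; c] \subset X, a != b, b != c & c != a].
Proof.
move=> X3; have /set0Pn[a aX] : X != set0 by rewrite -card_gt0; lia.
have X2 : (1 < #|X :\ a|)%N by move: X3; rewrite (cardsD1 a) aX.
have /set0Pn[b bX] : X :\ a != set0 by rewrite -card_gt0; lia.
have X1 : (0 < #|X :\ a :\ b|)%N by move: X2; rewrite (cardsD1 b (X :\ a)) bX.
have [c] : exists c, c \in X :\ a :\ b by apply/set0Pn; rewrite -card_gt0.
move: bX; rewrite !inE => /andP[ba bX] /and3P[cb ca cX].
by exists a, b, c; rewrite !subUset !sub1set aX bX cX eq_sym ba eq_sym cb ca.
Qed.

(** A triple of character [e] lies in [ntriples A e] blocks, up to a factor common to all triples,
    so the design condition says [ntriples A 1 = ntriples A (-1)]. Three points of [A] form a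
    nondegenerate triple, whence a positive [lambda]. *)
Theorem starter3P A : (2 < #|A|)%N ->
  starter3 [set Some x | x in A] <-> charsum A = 0.
Proof.
move=> A3; set B := [set Some x | x in A].
have q1 : (0 < #|F|.-1)%N by have := finNzRing_gt1 F; case: #|F| => [|[]].
have s0 := stab_size_gt0 B.
have key a b c : a != b -> b != c -> c != a ->
    (#|[set X in psl_orbit B | [set a; b; c] \subset X]| * stab_size B
     = ntriples A (qchi (tri a b c)) * #|F|.-1)%N.
  by move=> ab bc ca; rewrite -card_cover_orbit card_cover.
(* The invariant of this triple is [e] itself, so [e = 1] and [e = alpha] probe the two orbits of
   triples. *)
pose T0 (e : F) : {set option F} := [set None; Some (0 : F); Some e].
have keyi (e : F) : e != 0 -> (#|[set X in psl_orbit B | T0 e \subset X]| * stab_size B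
     = ntriples A (qchi e) * #|F|.-1)%N.
  by move=> e0; rewrite key ?tri_inf0 // (inj_eq Some_inj) eq_sym.
have [alpha pa] := finField_prim_root F.
have a0 := prim_root_neq0 pa.
have qa : qchi alpha = -1 by have := @qchi_prim_root _ oddF alpha 1 pa; rewrite expr1.
have o0 : (1 : F) != 0 := oner_neq0 F.
rewrite charsumE; split=> [[l [l0 Hl]]|/eqP].
  have c3 (e : F) : e != 0 -> #|T0 e| = 3%N.
    by move=> e0; rewrite cards3 // (inj_eq Some_inj) eq_sym.
  apply/eqP; rewrite subr_eq0 eqz_nat -(eqn_pmul2r q1) -qa -{1}(qchi1 F).
  by rewrite -!keyi ?Hl ?c3.
rewrite subr_eq0 eqz_nat => /eqP mm.
have nE (e : F) : e != 0 -> ntriples A (qchi e) = ntriples A 1.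
  by move=> /qchi_pm1[] ->.
exists #|[set X in psl_orbit B | T0 1 \subset X]|; split.
  rewrite -(ltn_pmul2r s0) mul0n keyi // qchi1 muln_gt0 q1 andbT.
  have [x [y [z [sA xy yz zx]]]] := cards3P A3.
  have d0 : disc (x, y, z) != 0 by rewrite /disc /= !mulf_neq0 // subr_eq0.
  rewrite -(nE _ d0) card_gt0; apply/set0Pn; exists (x, y, z); rewrite !inE /= eqxx andbT.
  by move: sA; rewrite !subUset !sub1set -andbA.
move=> T T3; have [|a [b [c [sT ab bc ca]]]] := @cards3P _ T; first by rewrite T3.
have -> : T = [set a; b; c].
  by apply/esym/eqP; rewrite eqEcard sT T3 cards3.
apply/eqP; rewrite -(eqn_pmul2r s0) key // keyi // !nE // ?oner_neq0 //.
by rewrite tri_neq0 ab bc.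
Qed.
End DoubleCounting.

(** * Fifth and tenth roots of unity *)

(** A sum that [vm_compute] can unfold, unlike the locked big operators. *)
Definition iota_sum (k : nat) (f : nat -> int) : int :=
  foldr (fun i s => f i + s) 0 (iota 0 k).

Lemma big_ord_iota_sum k (f : nat -> int) : \sum_(i < k) f i = iota_sum k f.
Proof. by rewrite -(big_mkord xpredT) /index_iota subn0 unlock. Qed.

(** Entry [d] of [e] stands for [chi (1 - g^d)]. The summand [k] in the index keeps the difference
    [i - j] from being truncated. *)
Definition cyclic_charsum (k : nat) (e : seq int) : int :=
  let s i j := nth 0 e ((i + k - j) %% k) in
  iota_sum k (fun i => iota_sum k (fun j => iota_sum k (fun l => s i j * s j l * s l i))).

Section CharsumRoots.
Variable F : finFieldType.
Hypothesis oddF : odd #|F|.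

Lemma root_set_imset k (g : F) : k.-primitive_root g ->
  [set x : F | x ^+ k == 1] = [set g ^+ i | i : 'I_k].
Proof.
move=> pg; apply/setP => x; rewrite inE; apply/eqP/imsetP => [/(prim_rootP pg)[i ->]|[i _ ->]].
  by exists i.
by rewrite exprAC (prim_expr_order pg) expr1n.
Qed.

Lemma prim_ord_inj k (g : F) : k.-primitive_root g -> injective (fun i : 'I_k => g ^+ i).
Proof.
move=> pg i j /eqP; rewrite (eq_prim_root_expr pg) !modn_small // => /eqP; exact: val_inj.
Qed.

Lemma card_root_set k (g : F) : k.-primitive_root g -> #|[set x : F | x ^+ k == 1]| = k.
Proof.
by move=> pg; rewrite (root_set_imset pg) card_imset ?card_ord //; apply: prim_ord_inj.
Qed.

Lemma charsum_roots k (g : F) : k.-primitive_root g ->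
  charsum [set x : F | x ^+ k == 1] =
  \sum_(i < k) \sum_(j < k) \sum_(l < k)
    (qchi (g ^+ i - g ^+ j) * qchi (g ^+ j - g ^+ l) * qchi (g ^+ l - g ^+ i)).
Proof.
move=> pg; set A := [set x : F | _].
have sumE (f : F -> int) : \sum_(x in A) f x = \sum_(i < k) f (g ^+ i).
  rewrite /A (root_set_imset pg) big_imset /=; first by apply: eq_bigl => i; rewrite inE.
  by move=> i j _ _; apply: prim_ord_inj.
transitivity (\sum_(x in A) \sum_(y in A) \sum_(z in A)
   (qchi (x - y) * qchi (y - z) * qchi (z - x))).
  rewrite pair_big pair_big /=; apply: eq_big => [u|u _]; first by rewrite inE andbA.
  by rewrite /disc !qchiM.
rewrite sumE; apply: eq_bigr => i _; rewrite sumE; apply: eq_bigr => j _.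
by rewrite sumE.
Qed.

Hypothesis qN1 : qchi (-1 : F) = 1.

Lemma qchiN (x : F) : qchi (- x) = qchi x.
Proof. by rewrite -mulN1r qchiM // qN1 mul1r. Qed.

(** Writing [g^i - g^j = - g^j (1 - g^(i - j))] and using that [-1] and [g] are squares, only the
    differences of exponents matter. *)
Lemma charsum_rootsE k (g : F) (e : seq int) : k.-primitive_root g -> qchi g = 1 ->
  (forall d, (d < k)%N -> qchi (1 - g ^+ d) = nth 0 e d) ->
  charsum [set x : F | x ^+ k == 1] = cyclic_charsum k e.
Proof.
move=> pg qg He; have k0 := prim_order_gt0 pg.
have sE i j : (i < k)%N -> (j < k)%N ->
    qchi (g ^+ i - g ^+ j) = nth 0 e ((i + k - j) %% k).
  move=> ik jk; rewrite -He ?ltn_mod // (prim_expr_mod pg).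
  have -> : g ^+ i - g ^+ j = - (g ^+ j * (1 - g ^+ (i + k - j))).
    rewrite mulrBr mulr1 -exprD subnKC; last by lia.
    by rewrite exprD (prim_expr_order pg) mulr1 opprB.
  by rewrite qchiN qchiM // qchiX // qg expr1n mul1r.
rewrite (charsum_roots pg) /cyclic_charsum -big_ord_iota_sum; apply: eq_bigr => i _.
rewrite -big_ord_iota_sum; apply: eq_bigr => j _; rewrite -big_ord_iota_sum.
by apply: eq_bigr => l _; rewrite !sE.
Qed.

Section FifthRoot.
Variable b : F.
Hypothesis pb : 5.-primitive_root b.
Hypothesis qb : qchi b = 1.

Lemma fifth_root_sum : 1 + b + b ^+ 2 + b ^+ 3 + b ^+ 4 = 0.
Proof.
have b1 : b != 1.
  by apply/negP => /eqP b1; have := prim_order_dvd pb 1; rewrite expr1 b1 eqxx.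
have /eqP : (b - 1) * (1 + b + b ^+ 2 + b ^+ 3 + b ^+ 4) = 0.
  by transitivity (b ^+ 5 - 1); [ring | rewrite (prim_expr_order pb) subrr].
by rewrite mulf_eq0 subr_eq0 (negbTE b1) => /eqP.
Qed.

Let b5 : b ^+ 5 = 1. Proof. exact: prim_expr_order pb. Qed.

Lemma qchi_fifth_exprM k x : qchi (b ^+ k * x) = qchi x.
Proof. by rewrite qchiM // qchiX // qb expr1n mul1r. Qed.

(** This and the next lemmas reduce all characters of [1 + b^k] and [1 - b^k] to those of [1 + b]
    and [1 - b]. *)
Lemma qchi_1Db2 : qchi (1 + b ^+ 2) = qchi (1 + b).
Proof.
have : qchi ((1 + b) * (1 + b ^+ 2)) = 1.
  have -> : (1 + b) * (1 + b ^+ 2) = - (b ^+ 4 * 1).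
    by apply/eqP; rewrite -subr_eq0 -[X in _ == X]fifth_root_sum; apply/eqP; ring.
  by rewrite qchiN qchi_fifth_exprM qchi1.
rewrite qchiM // => H; have b0 : 1 + b != 0 by rewrite -qchi_eq0; apply: contra_eq_neq H => ->; rewrite mul0r.
by rewrite -[LHS]mul1r -(qchi_sqr_eq1 b0) -mulrA H mulr1.
Qed.

Lemma qchi_1Db3 : qchi (1 + b ^+ 3) = qchi (1 + b).
Proof.
rewrite -qchi_1Db2 -(qchi_fifth_exprM 3 (1 + b ^+ 2)); congr qchi.
by rewrite mulrDr mulr1 -exprD b5 addrC.
Qed.

Lemma qchi_1Db4 : qchi (1 + b ^+ 4) = qchi (1 + b).
Proof.
by rewrite -(qchi_fifth_exprM 4 (1 + b)) mulrDr mulr1 -exprSr b5 addrC.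
Qed.

Lemma qchi_1Bb2 : qchi (1 - b ^+ 2) = qchi (1 - b) * qchi (1 + b).
Proof. by rewrite -qchiM //; congr qchi; ring. Qed.

Lemma qchi_1Bb3 : qchi (1 - b ^+ 3) = qchi (1 - b) * qchi (1 + b).
Proof.
rewrite -qchi_1Bb2 -(qchi_fifth_exprM 3 (1 - b ^+ 2)) -qchiN; congr qchi.
by rewrite mulrBr mulr1 -exprD b5 opprB.
Qed.

Lemma qchi_1Bb4 : qchi (1 - b ^+ 4) = qchi (1 - b).
Proof.
by rewrite -(qchi_fifth_exprM 4 (1 - b)) -qchiN mulrBr mulr1 -exprSr b5 opprB.
Qed.

Lemma fifth_1Bb_neq0 : 1 - b != 0.
Proof.
by rewrite subr_eq0 eq_sym; apply/negP => /eqP b1; have := prim_order_dvd pb 1; rewrite expr1 b1 eqxx.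
Qed.

Lemma fifth_1Db_neq0 : 1 + b != 0.
Proof.
have : 1 - b ^+ 2 != 0.
  by rewrite subr_eq0 eq_sym; apply/negP => b1; have := prim_order_dvd pb 2; rewrite b1.
by apply: contraNN => /eqP b1; have -> : 1 - b ^+ 2 = (1 - b) * (1 + b) by [ring]; rewrite b1 mulr0.
Qed.

Lemma charsum_fifth_roots :
  charsum [set x : F | x ^+ 5 == 1] = 0 <-> qchi (1 + b) = -1.
Proof.
rewrite (@charsum_rootsE 5 b [:: 0; qchi (1 - b); qchi (1 - b) * qchi (1 + b);
    qchi (1 - b) * qchi (1 + b); qchi (1 - b)]) //; last first.
  case=> [|[|[|[|[|//]]]]] _ /=; rewrite ?expr0 ?subrr ?qchi0 ?expr1 //.
  - exact: qchi_1Bb2.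
  - exact: qchi_1Bb3.
  - exact: qchi_1Bb4.
(* With [s = chi (1 - b)] and [v = chi (1 + b)], the sum is [30 s (1 + v)]. *)
case: (qchi_pm1 fifth_1Bb_neq0) => ->; case: (qchi_pm1 fifth_1Db_neq0) => ->; by vm_compute.
Qed.

Lemma charsum_tenth_roots (c : F) : 10.-primitive_root c -> qchi c = 1 -> c ^+ 2 = b ->
  charsum [set x : F | x ^+ 10 == 1] = 0 <-> qchi (1 + b) = -1.
Proof.
move=> pc qc c2; have c10 := prim_expr_order pc.
have c5 : c ^+ 5 = -1.
  have : (c ^+ 5) ^+ 2 == 1 by rewrite -exprM c10.
  by rewrite sqrf_eq1 -(prim_order_dvd pc) /= => /eqP.
have cE k : c ^+ k.*2 = b ^+ k by rewrite -c2 -exprM mul2n.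
have cO k : c ^+ (k.*2 + 5)%N = - b ^+ k by rewrite exprD cE c5 mulrN1.
have cO' k : (5 <= k.*2 )%N -> c ^+ (k.*2 - 5)%N = - b ^+ k.
  move=> k5; rewrite -cO -(prim_expr_mod pc) -[RHS](prim_expr_mod pc); congr (_ ^+ _); lia.
rewrite (@charsum_rootsE 10 c [:: 0; qchi (1 + b); qchi (1 - b); qchi (1 + b);
    qchi (1 - b) * qchi (1 + b); qchi (2%:R : F); qchi (1 - b) * qchi (1 + b); qchi (1 + b);
    qchi (1 - b); qchi (1 + b)]) //; last first.
  case=> [|[|[|[|[|[|[|[|[|[|//]]]]]]]]]] _ /=; rewrite ?expr0 ?subrr ?qchi0 //.
  - by rewrite (cO' 3) // opprK qchi_1Db3.
  - by rewrite (cE 1%N) expr1.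
  - by rewrite (cO' 4) // opprK qchi_1Db4.
  - by rewrite (cE 2) qchi_1Bb2.
  - by rewrite c5 opprK.
  - by rewrite (cE 3) qchi_1Bb3.
  - by rewrite (cO 1%N) opprK expr1.
  - by rewrite (cE 4) qchi_1Bb4.
  - by rewrite (cO 2) opprK qchi_1Db2.
(* With [w = chi 2] in addition, the sum is [120 s (1 + v) (2 + w)], and [2 + w] is 1 or 3. *)
case: (qchi_pm1 (two_neq0 oddF)) => ->;
case: (qchi_pm1 fifth_1Bb_neq0) => ->; case: (qchi_pm1 fifth_1Db_neq0) => ->; by vm_compute.
Qed.
End FifthRoot.
End CharsumRoots.

Section MinusOne.
Variables (F : finFieldType) (alpha : F).
Hypothesis q1 : (4 %| #|F|.-1)%N.
Hypothesis pa : (#|F|.-1).-primitive_root alpha.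

Lemma sqr_prim_root_quarter : (alpha ^+ (#|F|.-1 %/ 4)) ^+ 2 = -1.
Proof.
have q0 := prim_order_gt0 pa; have [k qk] := dvdnP q1.
rewrite -exprM; apply/eqP.
have : (alpha ^+ (#|F|.-1 %/ 4 * 2)) ^+ 2 == 1.
  by rewrite -exprM -mulnA divnK // (prim_expr_order pa).
rewrite sqrf_eq1 -(prim_order_dvd pa) qk mulnK // => /orP[|//].
by move/dvdn_leq; lia.
Qed.

Lemma odd_of_dvd4 : odd #|F|.
Proof. by have := prim_order_gt0 pa; have [k] := dvdnP q1; lia. Qed.

Lemma qchi_quarter : qchi (alpha ^+ (#|F|.-1 %/ 4)) = (-1) ^+ (#|F|.-1 %/ 4).
Proof. by rewrite (qchi_prim_root odd_of_dvd4 _ pa). Qed.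

Lemma qchi_m1 : qchi (-1 : F) = 1.
Proof.
rewrite -sqr_prim_root_quarter qchi_sqr // expf_neq0 //; exact: prim_root_neq0 pa.
Qed.
End MinusOne.

(** * Gaussian periods, the equation for [theta], and the quartic character of 5 *)

Section GoldenRatio.
Variables (F : finFieldType) (b : F).
Hypothesis oddF : odd #|F|.
Hypothesis qN1 : qchi (-1 : F) = 1.
Hypothesis pb : 5.-primitive_root b.
Hypothesis qb : qchi b = 1.

Let t := b + b ^+ 4.

Let t2 : t ^+ 2 = 1 - t.
Proof.
have e : t ^+ 2 = b ^+ 2 + 2 * b ^+ 5 + b ^+ 5 * b ^+ 3 by rewrite /t; ring.
apply/eqP; rewrite -subr_eq0 e (prim_expr_order pb); apply/eqP.
by rewrite -[RHS](fifth_root_sum pb) /t; ring.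
Qed.

Let qt : qchi t = qchi (1 + b).
Proof.
rewrite -(qchi_1Db3 oddF qN1 pb qb) -(qchi_fifth_exprM oddF qb 1 (1 + b ^+ 3)).
by congr qchi; rewrite /t; ring.
Qed.

Let qt' : qchi (-1 - t) = qchi (1 + b).
Proof.
rewrite -(qchi_fifth_exprM oddF qb 2 (1 + b)); congr qchi.
by apply/eqP; rewrite -subr_eq0 -oppr_eq0 -[X in _ == X](fifth_root_sum pb) /t; apply/eqP; ring.
Qed.

Let qcube (x : F) : qchi (- x ^+ 3) = qchi x.
Proof.
rewrite qchiN // exprSr; have [->|x0] := eqVneq x 0; first by rewrite mulr0.
by rewrite qchi_sqrM.
Qed.

(** In terms of [sqrt5 = 2 t + 1], the roots [- t^3] and [- (-1 - t)^3] are [2 - sqrt5] and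
    [2 + sqrt5]. *)
Lemma theta_factor (x : F) : x ^+ 2 - 4%:R * x - 1 = (x + t ^+ 3) * (x + (-1 - t) ^+ 3).
Proof.
have t3 : t ^+ 3 = 2%:R * t - 1.
  by rewrite exprS t2 mulrBr -expr2 t2; ring.
have t'3 : (-1 - t) ^+ 3 = - 3%:R - 2%:R * t.
  by transitivity (- (1 + 3%:R * t + 3%:R * t ^+ 2 + t ^+ 3)); [ring | rewrite t3 t2; ring].
by rewrite t3 t'3; transitivity (x ^+ 2 - 4%:R * x + 3%:R - 4%:R * t - 4%:R * t ^+ 2); [rewrite t2; ring | ring].
Qed.

Lemma qchi_theta (x : F) : x ^+ 2 - 4%:R * x - 1 = 0 -> qchi x = qchi (1 + b).
Proof.
move=> /eqP; rewrite theta_factor mulf_eq0 !addr_eq0 => /orP[] /eqP ->.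
  by rewrite qcube qt.
by rewrite qcube qt'.
Qed.

Lemma exists_theta : exists x : F, x ^+ 2 - 4%:R * x - 1 = 0.
Proof. by exists (- t ^+ 3); rewrite theta_factor addNr mul0r. Qed.

Lemma theta_nonsquareP :
  qchi (1 + b) = -1 <->
  exists x : F, [/\ x != 0, qchi x = -1 & x ^+ 2 - 4%:R * x - 1 = 0].
Proof.
split=> [v|[x [_ qx ex]]]; last by rewrite -(qchi_theta ex).
have [x ex] := exists_theta; exists x; have qx := qchi_theta ex.
by rewrite -qchi_eq0 qx v.
Qed.

(** The difference of the two periods, that is the quadratic Gauss sum [b - b^2 - b^3 + b^4]. *)
Definition sqrt5 : F := 2%:R * t + 1.

Lemma sqr_sqrt5 : sqrt5 ^+ 2 = 5%:R.
Proof.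
by transitivity (4%:R * t ^+ 2 + 4%:R * t + 1); [rewrite /sqrt5; ring | rewrite t2; ring].
Qed.

Lemma qchi_sqrt5 : qchi sqrt5 = qchi (1 + b).
Proof.
have -> : sqrt5 = b ^+ 1 * ((1 - b) ^+ 2 * (1 + b)).
  apply/eqP; rewrite -subr_eq0 -[X in _ == X](fifth_root_sum pb) /sqrt5 /t; apply/eqP; ring.
by rewrite qchi_fifth_exprM // qchi_sqrM // fifth_1Bb_neq0.
Qed.

(** From [y^4 = 5 = sqrt5^2] follows [sqrt5 = y^2] or [sqrt5 = - y^2]; since [-1] is a square, 5 is
    a fourth power exactly when [sqrt5] is a square. *)
Lemma fourth_power_five (alpha : F) : (#|F|.-1).-primitive_root alpha -> 5%:R != 0 :> F ->
  qchi (1 + b) = -1 <-> ~ exists n, (alpha ^+ 4) ^+ n = 5%:R.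
Proof.
move=> pa n5; rewrite -qchi_sqrt5.
have r0 : sqrt5 != 0 by apply: contraNneq n5 => r0; rewrite -sqr_sqrt5 r0 expr0n.
split=> [qr [n]|H].
  have -> : (alpha ^+ 4) ^+ n = ((alpha ^+ n) ^+ 2) ^+ 2 by rewrite -!exprM; congr (_ ^+ _); lia.
  have y0 : alpha ^+ n != 0 by rewrite expf_neq0 // (prim_root_neq0 pa).
  move: (alpha ^+ n) y0 => y y0 /eqP; rewrite -sqr_sqrt5 eqf_sqr => /orP[] /eqP e.
    by move: qr; rewrite -e qchi_sqr.
  by move: qr; rewrite -[sqrt5]opprK -e qchiN // qchi_sqr.
case: (qchi_pm1 r0) => // /eqP/qchi1P[_ [y yr]]; case: H.
have y0 : y != 0 by apply: contraNneq r0 => y0; rewrite -yr y0 expr0n.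
have [n yn] := prim_root_exp pa y0; exists n.
by rewrite -sqr_sqrt5 -yr yn -!exprM; congr (_ ^+ _); lia.
Qed.
End GoldenRatio.

(** * Reciprocity *)

Lemma card_finField_natr (F : finFieldType) : #|F|%:R = 0 :> F.
Proof.
have := @expg_cardG F [set: F]%G 1%R (in_setT _).
by rewrite cardsT FinRing.zmodXgE.
Qed.

Lemma natr_coprime_card_neq0 (F : finFieldType) n : coprime n #|F| -> n%:R != 0 :> F.
Proof.
case: n => [|n]; first by rewrite /coprime gcd0n => /eqP q1; have := finNzRing_gt1 F; rewrite q1.
move=> cn; have [u v e _] := @egcdnP n.+1 #|F| isT.
apply/eqP => n0; have /(congr1 (fun m => m%:R : F)) := e.
rewrite (eqP cn) natrD !natrM n0 card_finField_natr !mulr0 add0r => /eqP.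
by rewrite eq_sym oner_eq0.
Qed.

Section SumsOfSquares.
Variable F : finFieldType.
Local Notation q := #|F|.

(** Points of a sphere are stored as tuples so that cyclic rotation can act on them. *)
Definition nsqsum n (c : F) := #|[set t : n.-tuple F | \sum_(x <- t) x ^+ 2 == c]|.

Lemma nsqsum0 c : nsqsum 0 c = (c == 0).
Proof.
rewrite /nsqsum; case: eqP => [->|c0].
  rewrite (_ : [set _ | _] = [set: 0.-tuple F]) ?cardsT ?card_tuple ?expn0 //.
  by apply/setP => t; rewrite !inE tuple0 big_nil eqxx.
by apply: eq_card0 => t; rewrite !inE tuple0 big_nil eq_sym; apply/eqP.
Qed.

Lemma nsqsumS n c : nsqsum n.+1 c = (\sum_(x : F) nsqsum n (c - x ^+ 2)%R)%N.
Proof.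
have nE m d : nsqsum m d = (\sum_(t : m.-tuple F) (\sum_(x <- t) x ^+ 2 == d)%R)%N.
  by rewrite /nsqsum -sum1_card big_mkcond; apply: eq_bigr => t _; rewrite inE; case: ifP.
rewrite nE (reindex (fun p : F * n.-tuple F => [tuple of p.1 :: p.2])) /=.
  rewrite -(pair_bigA _ (fun x (t : n.-tuple F) => (\sum_(y <- x :: t) y ^+ 2 == c)%R : nat)) /=.
  apply: eq_bigr => x _; rewrite nE; apply: eq_bigr => t _.
  by rewrite big_cons [in RHS]eq_sym subr_eq eq_sym addrC.
exists (fun t : n.+1.-tuple F => (thead t, [tuple of behead t])) => [[x t] _|t _] /=.
  by congr (_, _); apply: val_inj.
by rewrite [RHS]tuple_eta.
Qed.

Lemma sum_nsqsum n : (\sum_(c : F) nsqsum n c)%N = (q ^ n)%N.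
Proof.
rewrite -(card_tuple n F) -sum1_card (partition_big (fun t : n.-tuple F => \sum_(x <- t) x ^+ 2) xpredT) //=.
by apply: eq_bigr => c _; rewrite /nsqsum -sum1_card; apply: eq_bigl => t; rewrite inE.
Qed.

Hypothesis oddF : odd q.
Variable i : F.
Hypothesis i2 : i ^+ 2 = -1.

(** As [-1] is a square, [x^2 + y^2] is a product [u v] in new coordinates. The line [u = 0] gives
    [q] copies of the count for [c]; for each other [u], the value [c - u v] runs over the whole
    field, which gives [q^n]. *)
Lemma nsqsumSS n c : nsqsum n.+2 c = (q * nsqsum n c + q.-1 * q ^ n)%N.
Proof.
have i0 : i != 0 by apply: contra_eq_neq i2 => ->; rewrite expr0n eq_sym oppr_eq0 oner_eq0.
have two0 := two_neq0 oddF.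
pose h (p : F * F) := (p.1 + i * p.2, p.1 - i * p.2).
have hbij : bijective h.
  apply: injF_bij => -[x y] [x' y'] [e1 e2].
  have ex : 2%:R * x = 2%:R * x'.
    by transitivity ((x + i * y) + (x - i * y)); [ring | rewrite e1 e2; ring].
  have ey : 2%:R * i * y = 2%:R * i * y'.
    by transitivity ((x + i * y) - (x - i * y)); [ring | rewrite e1 e2; ring].
  by rewrite (mulfI two0 ex) (mulfI _ ey) // mulf_neq0.
rewrite nsqsumS (eq_bigr _ (fun x _ => nsqsumS n (c - x ^+ 2))) pair_bigA /=.
transitivity (\sum_(p : F * F) nsqsum n (c - p.1 * p.2)%R)%N.
  rewrite [RHS](reindex h) /=; last exact: onW_bij.
  apply: eq_bigr => -[x y] _ /=; congr nsqsum.
  by transitivity (c - x ^+ 2 + i ^+ 2 * y ^+ 2); [rewrite i2; ring | ring].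
rewrite -(pair_bigA _ (fun x y => nsqsum n (c - x * y))) /= (bigD1 (0 : F)) //=; congr addn.
  by rewrite (eq_bigr (fun=> nsqsum n c)) ?sum_nat_const // => y _; rewrite mul0r subr0.
rewrite (eq_bigr (fun=> (q ^ n)%N)).
  by rewrite sum_nat_const; congr (_ * _)%N; rewrite -(cardC1 (0 : F)); apply: eq_card.
move=> x x0; rewrite -sum_nsqsum [RHS](reindex (fun y => c - x * y)) //.
by apply/onW_bij/injF_bij => y y' /addrI/oppr_inj/(mulfI x0).
Qed.

Lemma nsqsum_odd m : nsqsum m.*2.+1 1 = (q ^ m.*2 + q ^ m)%N.
Proof.
have q0 : (0 < q)%N := ltnW (finNzRing_gt1 F).
elim: m => [|m IH].
  rewrite nsqsumS (eq_bigr _ (fun x _ => nsqsum0 (1 - x ^+ 2))) (bigD1 (1 : F)) //=.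
  rewrite (bigD1 (-1 : F)) /=.
    rewrite big1 => [|x /andP[x1 xN1]]; first by rewrite expr1n sqrrN expr1n subrr eqxx.
    by apply/eqP; rewrite eqb0 subr_eq0 eq_sym sqrf_eq1 negb_or x1 xN1.
  rewrite -subr_eq0 -opprD oppr_eq0; exact: two_neq0.
rewrite doubleS nsqsumSS IH !expnS; case: (q) q0 => // k _ /=; nia.
Qed.
End SumsOfSquares.

Lemma rot1_fixed (T : Type) (x : T) s : rot 1%N (x :: s) = x :: s -> s = nseq (size s) x.
Proof.
rewrite rot1_cons; elim: s => //= y s IH [-> e].
by rewrite {1}(IH e).
Qed.

Section Reciprocity.
Variables (F : finFieldType) (l : nat).
Hypothesis oddF : odd #|F|.
Hypothesis prl : prime l.

Definition rotation_fun (t : l.-tuple F) : l.-tuple F := [tuple of rot 1%N t].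

Lemma rotation_inj : injective rotation_fun.
Proof. by move=> t u /(congr1 val) /rot_inj /val_inj. Qed.

Definition rotation := perm rotation_inj.

Lemma rotation_pow k (t : l.-tuple F) : (k <= l)%N -> (rotation ^+ k)%g t = rot k t :> seq F.
Proof.
elim: k => [|k IH] kl; first by rewrite perm1 rot0.
by rewrite expgSr permM permE /= IH 1?ltnW // -rotS // size_tuple.
Qed.

Lemma rotation_order : (#[rotation]%g %| l)%N.
Proof.
rewrite order_dvdn; apply/eqP/permP => t; apply: val_inj.
by rewrite [LHS]rotation_pow // perm1 rot_oversize // size_tuple.
Qed.

(** Rotations form an [l]-group acting on the sphere, whose size is therefore congruent to the
    number of fixed points: the constant tuples [x] with [l x^2 = 1]. *)
Lemma nsqsum_prime_mod :
  nsqsum l (1 : F) = #|[set x : F | l%:R * x ^+ 2 == 1]| %[mod l].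
Proof.
set S := [set t : l.-tuple F | \sum_(x <- t) x ^+ 2 == 1].
have pG : (l.-group <[rotation]>)%g.
  by rewrite /pgroup -orderE; apply: pnat_dvd rotation_order (pnat_id prl).
have aG : [acts <[rotation]>%g, on S | 'P].
  rewrite cycle_subG !inE /=; apply/subsetP => t; rewrite !inE /= apermE permE.
  have pt : perm_eq (rot 1%N t) t by rewrite perm_rot.
  by rewrite (perm_big _ pt).
rewrite /nsqsum (pgroup_fix_mod pG aG); congr (_ %% _)%N.
have inj : injective (fun x : F => [tuple of nseq l x]).
  move=> x y /(congr1 val) /=; case: (l) (prime_gt0 prl) => // k _ [] //.
rewrite -(card_imset _ inj); apply: eq_card => t.
apply/setIP/imsetP => [[tS]|[x]]; rewrite afix_cycle.
  move=> /afix1P; rewrite /= apermE permE => /(congr1 val) /= rt.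
  have gen (s : seq F) : size s = l -> rot 1%N s = s -> exists x, s = nseq l x.
    case: s => [|x s] sl rs; first by have := prime_gt0 prl; rewrite -sl.
    by exists x; rewrite -sl /= -(rot1_fixed rs).
  have [x tx] := gen _ (size_tuple t) rt.
  exists x; last exact: val_inj.
  move: tS; rewrite !inE tx big_nseq iter_addr_0 mulr_natl.
  exact.
rewrite inE => lx ->; split.
  by rewrite inE big_nseq iter_addr_0 -mulr_natl.
apply/afix1P; rewrite /= apermE permE; apply: val_inj => /=.
case: (l) => // k; rewrite /= rot1_cons; elim: k => //= k ->.
by [].
Qed.

Lemma card_scaled_square (a : F) : a != 0 ->
  #|[set x : F | a * x ^+ 2 == 1]| = if qchi a == 1 then 2 else 0%N.
Proof.
move=> a0; case: qchi1P => [[_ [y ya]]|na].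
  have y0 : y != 0 by apply: contraNneq a0 => y0; rewrite -ya y0 expr0n.
  have -> : [set x : F | a * x ^+ 2 == 1] = [set y^-1; - y^-1].
    apply/setP => x; rewrite !inE -eqf_sqr -ya exprVn.
    by rewrite -[in RHS](inj_eq (mulfI (expf_neq0 2 y0))) divff // expf_neq0.
  have yN : y^-1 != - y^-1.
    by rewrite -addr_eq0 -[_ + _]mulr2n -[_ *+ 2]mulr_natl mulf_neq0 ?invr_eq0 // two_neq0.
  by rewrite cards2 yN.
apply: eq_card0 => x; rewrite !inE; apply/negP => /eqP ax; apply: na; split=> //.
exists x^-1; have x0 : x != 0.
  by apply: contra_eq_neq ax => ->; rewrite expr0n mulr0 eq_sym oner_eq0.
by rewrite exprVn; apply: (mulIf (expf_neq0 2 x0)); rewrite ax mulVf // expf_neq0.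
Qed.

(* Quadratic reciprocity when [-1] is a square, by counting modulo [l] the points
   of the unit sphere in dimension [l] (V.-A. Lebesgue). *)
Theorem reciprocity (i : F) : i ^+ 2 = -1 -> odd l -> coprime l #|F| ->
  (qchi (l%:R : F) == 1) = (#|F| ^ l./2 == 1 %[mod l]).
Proof.
move=> i2 ol cl; have l0 := natr_coprime_card_neq0 cl.
have lE : l = (l./2).*2.+1 by rewrite -[LHS]odd_double_half ol.
have := nsqsum_prime_mod; rewrite {1}lE (nsqsum_odd oddF i2) card_scaled_square //.
have : #|F| ^ (l./2).*2 = 1 %[mod l].
  have -> : (l./2).*2 = totient l by rewrite totient_prime // {2}lE.
  by apply: Euler_exp_totient; rewrite coprime_sym.
have l2 : (2 < l)%N by have := prime_gt1 prl; lia.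
move=> H; rewrite -modnDml H modnDml; move: (#|F| ^ _)%N => n.
case: (_ == 1) => e; apply/esym.
  by apply/eqP/eqP; rewrite -(eqn_modDl 1) e.
apply/negP => /eqP n1; move: e; rewrite -modnDmr n1 modnDmr mod0n.
by rewrite modn_small.
Qed.
End Reciprocity.

(** * Primes represented by quadratic forms *)

(** Used to pass from the prime divisors of an integer to its character. *)
Lemma mul_funs_eq (f g : nat -> int) n :
  (forall a b, f (a * b)%N = f a * f b) -> (forall a b, g (a * b)%N = g a * g b) ->
  f 1%N = g 1%N -> (0 < n)%N ->
  (forall l, prime l -> (l %| n)%N -> f l = g l) -> f n = g n.
Proof.
move=> fM gM fg1; elim/ltn_ind: n => n IH n0 H.
have [n1|n1] := leqP n 1; first by have -> : n = 1%N by lia.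
have pn := pdiv_prime n1; have [k nk] := dvdnP (pdiv_dvd n).
have k0 : (0 < k)%N by lia.
have kn : (k < n)%N by have := prime_gt1 pn; nia.
rewrite nk fM gM (H _ pn (pdiv_dvd n)) (IH k) // => l pl lk; apply: H => //.
by rewrite nk dvdn_mulr.
Qed.

Lemma prime_neq_sqr n x : prime n -> n <> (x ^ 2)%N.
Proof.
move=> /primeP[n1 H] e; have := H x; rewrite e -mulnn dvdn_mulr // => /(_ isT).
by case/orP => /eqP; nia.
Qed.

Lemma even_double n : ~~ odd n -> exists m, n = (2 * m)%N.
Proof. by move=> en; exists n./2; lia. Qed.

Lemma odd_sqr_mod8 n : odd n -> exists m, (n ^ 2 = 8 * m + 1)%N.
Proof.
move=> on; have [k nk] : exists k, n = (2 * k + 1)%N by exists n./2; lia.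
have [m km] : exists m, (k * k + k = 2 * m)%N.
  by apply: even_double; rewrite oddD oddM; case: (odd k).
by exists m; rewrite nk (_ : (2 * k + 1) ^ 2 = 4 * (k * k + k) + 1)%N; [lia | ring].
Qed.

Lemma sum_sqr_mod4_even x y : ((x ^ 2 + y ^ 2) %% 4 = 0)%N -> ~~ odd x /\ ~~ odd y.
Proof.
have sq n : (n ^ 2 %% 4 = odd n)%N.
  case: (boolP (odd n)) => [/odd_sqr_mod8[m ->]|/even_double[m ->]]; first by lia.
  rewrite (_ : (2 * m) ^ 2 = m * m * 4)%N ?modnMl //; ring.
by rewrite -modnDm !sq; case: (odd x); case: (odd y).
Qed.

Lemma form5_mod8_odd y z : odd y -> ~~ odd z -> (((2 * z) ^ 2 + 5 * y ^ 2) %% 8 = 5)%N.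
Proof. by move=> /odd_sqr_mod8[m ->] /even_double[w ->]; lia. Qed.

Lemma form5_mod8_even x z : odd x -> ~~ odd z -> ((x ^ 2 + 5 * (2 * z) ^ 2) %% 8 = 1)%N.
Proof. by move=> /odd_sqr_mod8[m ->] /even_double[w ->]; lia. Qed.

Lemma modn_multiple_sqr c k z : (k * (2 * z) ^ 2 + c = c %[mod z])%N.
Proof.
by rewrite (_ : k * (2 * z) ^ 2 + c = (4 * k * z) * z + c)%N ?modnMDl //; ring.
Qed.

Lemma sum_sqr_mod5_ndvd a b : ((a ^ 2 + b ^ 2) %% 5 = 1)%N -> ~~ (5 %| a + 2 * b)%N.
Proof.
rewrite /dvdn -modnDm -(modnXm 2 5 a) -(modnXm 2 5 b) -[((a + _) %% 5)%N]modnDm -(modnMmr 2 b).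
have := ltn_pmod a (isT : 0 < 5)%N; have := ltn_pmod b (isT : 0 < 5)%N.
by case: (a %% 5)%N => [|[|[|[|[|]]]]] //; case: (b %% 5)%N => [|[|[|[|[|]]]]].
Qed.

Section FiveElements.
Let chi5 n := qchi (n%:R : 'F_5).

Lemma odd_card_F5 : odd #|'F_5|. Proof. by rewrite card_Fp. Qed.

Lemma chi5M a b : chi5 (a * b)%N = chi5 a * chi5 b.
Proof. by rewrite /chi5 natrM qchiM // odd_card_F5. Qed.

Lemma chi5_mod n : chi5 n = chi5 (n %% 5).
Proof. by rewrite /chi5; congr qchi; apply: val_inj; rewrite /= !val_Fp_nat //= modn_mod. Qed.

Lemma chi5_1 : chi5 1 = 1. Proof. exact: qchi1. Qed.

Lemma chi5_4 : chi5 4 = 1.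
Proof. by rewrite /chi5 (natrM _ 2 2) -expr2 qchi_sqr. Qed.

Lemma chi5_2 : chi5 2 = -1.
Proof.
case: (@qchi_pm1 'F_5 2%:R isT) => // /eqP/qchi1P[_ [y]].
by case: y => [[|[|[|[|[|]]]]] //= iy] /(congr1 val).
Qed.

Lemma chi5_3 : chi5 3 = -1.
Proof.
have e : chi5 6 = chi5 2 * chi5 3 := chi5M 2 3.
rewrite chi5_mod chi5_1 chi5_2 in e.
by apply: (@mulrI _ (-1)) => //; rewrite -e mulrNN mulr1.
Qed.

Lemma chi5_sqr_mod x : (x ^ 2 %% 5 = 1)%N -> chi5 x = 1.
Proof.
move=> H; rewrite chi5_mod; have : (x %% 5 < 5)%N by rewrite ltn_mod.
move: H; rewrite -modnXm; case: (x %% 5)%N => [|[|[|[|[|]]]]] // _ _.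
  exact: chi5_1.
exact: chi5_4.
Qed.

(** Squares modulo 5 are 0, 1 and 4, so one of [a], [b] is 0 and the other is 1 or -1. Then
    [a + 2 b] is 1 or -1 if [b] vanishes, and otherwise 2 or -2, nonsquares. *)
Lemma chi5_sum_sqr a b : ((a ^ 2 + b ^ 2) %% 5 = 1)%N ->
  chi5 (a + 2 * b) = if (5 %| b)%N then 1 else -1.
Proof.
rewrite chi5_mod /dvdn -modnDm -(modnXm 2 5 a) -(modnXm 2 5 b) -[((a + _) %% 5)%N]modnDm -(modnMmr 2 b).
have := ltn_pmod a (isT : 0 < 5)%N; have := ltn_pmod b (isT : 0 < 5)%N.
by case: (a %% 5)%N => [|[|[|[|[|]]]]] //; case: (b %% 5)%N => [|[|[|[|[|]]]]] // _ _ _;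
  rewrite ?chi5_1 ?chi5_2 ?chi5_3 ?chi5_4.
Qed.
End FiveElements.

(** * Characters evaluated from the representations of [p] by the two forms *)

Section PrimeField.
Variables (F : finFieldType) (alpha : F).
Local Notation p := #|F|.
Hypothesis prp : prime p.
Hypothesis p20 : (p %% 20 = 1)%N.
Hypothesis pa : (p.-1).-primitive_root alpha.

Let q1 : (4 %| p.-1)%N. Proof. by have := prime_gt0 prp; lia. Qed.
Let oddF : odd p. Proof. by lia. Qed.
Let p5 : (p %% 5 = 1)%N. Proof. by lia. Qed.
Let i := alpha ^+ (p.-1 %/ 4).
Let i2 : i ^+ 2 = -1. Proof. exact: sqr_prim_root_quarter. Qed.
Let qN1 : qchi (-1 : F) = 1. Proof. exact: qchi_m1 pa. Qed.
Let chi n := qchi (n%:R : F).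
Let chi5 n := qchi (n%:R : 'F_5).

Let chiM a b : chi (a * b)%N = chi a * chi b.
Proof. by rewrite /chi natrM qchiM. Qed.

Lemma natr_small_neq0 n : (0 < n < p)%N -> n%:R != 0 :> F.
Proof.
case/andP=> n0 np; apply: natr_coprime_card_neq0.
by rewrite coprime_sym prime_coprime //; apply/negP => /dvdn_leq; lia.
Qed.

Lemma qchi_2i : qchi (2%:R * i) = 1.
Proof.
have <- : (1 + i) ^+ 2 = 2%:R * i by transitivity (1 + 2%:R * i + i ^+ 2); [ring | rewrite i2; ring].
rewrite qchi_sqr // addrC addr_eq0; apply: contra_eq_neq i2 => ->; rewrite sqrrN expr1n -addr_eq0 -mulr2n.
exact: two_neq0.
Qed.

(** As [2 i] is a square, [chi 2 = chi i], which is the sign of parity [(p - 1) / 4]. *)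
Lemma chi_2 : chi 2 = if (p %% 8 == 1)%N then 1 else -1.
Proof.
have i0 : i != 0 by rewrite expf_neq0 // (prim_root_neq0 pa).
have := qchi_2i; rewrite qchiM // => H.
have -> : chi 2 = qchi i by rewrite -[LHS]mulr1 -(qchi_sqr_eq1 i0) mulrA H mul1r.
rewrite /i qchi_quarter // -signr_odd; have := prime_gt0 prp.
by case: eqP => e; case: (boolP (odd _)) => //; move: p e p20 => *; lia.
Qed.

Lemma chi_prime_sqr l y : prime l -> odd l -> coprime l p -> p = y ^ 2 %[mod l] -> chi l = 1.
Proof.
move=> pl ol cl py; apply/eqP; rewrite (reciprocity oddF pl i2 ol cl).
rewrite -modnXm py modnXm -expnM mul2n (_ : l./2.*2 = totient l); last first.
  by rewrite totient_prime //; lia.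
apply/eqP/Euler_exp_totient.
by rewrite -(@coprime_pexpl 2) // -coprime_modl -py coprime_modl coprime_sym.
Qed.

Let sqr2F5 : (2%:R : 'F_5) ^+ 2 = -1. Proof. exact: val_inj. Qed.

(** Reciprocity is applied in [F] and in ['F_5], where 2 is a square root of [-1]. Both criteria
    agree because [p] and 5 have the same power of exponent [(l - 1) / 2] modulo [l]. *)
Lemma chi_prime_5sqr l y : prime l -> odd l -> coprime l p -> coprime l 5 ->
  p = 5 * y ^ 2 %[mod l] -> chi l = chi5 l.
Proof.
move=> pl ol cl cl5 py.
have l5 : coprime l #|'F_5| by rewrite card_Fp.
have key : (chi l == 1) = (chi5 l == 1).
  rewrite (reciprocity oddF pl i2 ol cl) (reciprocity odd_card_F5 pl sqr2F5 ol l5).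
  rewrite -modnXm py modnXm card_Fp // expnMn -expnM mul2n (_ : l./2.*2 = totient l); last first.
    by rewrite totient_prime //; lia.
  rewrite -modnMmr Euler_exp_totient ?modnMmr ?muln1 //.
  have : coprime (5 * y ^ 2) l by rewrite -coprime_modl -py coprime_modl coprime_sym.
  by rewrite coprimeMl coprime_pexpl // => /andP[].
have := qchi_pm1 (natr_coprime_card_neq0 cl); have := qchi_pm1 (natr_coprime_card_neq0 l5).
by move: key; rewrite /chi /chi5 => + [] e [] e' ; rewrite e e'.
Qed.

Lemma coprime_prime_dvd l n : prime l -> (l %| n)%N -> n%:R != 0 :> F -> coprime l p.
Proof.
move=> pl ln n0; rewrite coprime_sym prime_coprime // dvdn_prime2 //.
apply: contraNneq n0 => pl'; have [k ->] := dvdnP ln.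
by rewrite -pl' natrM card_finField_natr mulr0.
Qed.

Lemma natr_neq0_gt0 n : n%:R != 0 :> F -> (0 < n)%N.
Proof. by case: n; rewrite ?eqxx. Qed.

(** The last hypothesis takes care of the divisor 2: either it does not occur, or [chi 2 = 1]. *)
Lemma chi_sqr_mod n y : n%:R != 0 :> F -> p = y ^ 2 %[mod n] ->
  odd n \/ (p %% 8 = 1)%N -> chi n = 1.
Proof.
move=> n0 py H; rewrite -[RHS]/((fun=> 1 : int) n).
apply: mul_funs_eq => //; [exact: qchi1 | exact: natr_neq0_gt0 | move=> l pl ln].
have [l2|ol] := even_prime pl.
  rewrite l2 chi_2; case: H => [on|->//].
  by move: ln; rewrite l2 dvdn2 on.
apply: (@chi_prime_sqr l y) => //; first exact: coprime_prime_dvd n0.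
by rewrite -(modn_dvdm p ln) py modn_dvdm.
Qed.

(** Here [p = 5] modulo 8 is the right alternative for even [n], since it gives
    [chi 2 = -1 = chi5 2]. *)
Lemma chi_5sqr_mod n y : n%:R != 0 :> F -> ~~ (5 %| n)%N -> p = 5 * y ^ 2 %[mod n] ->
  odd n \/ (p %% 8 = 5)%N -> chi n = chi5 n.
Proof.
move=> n0 n5 py H.
apply: mul_funs_eq; [exact: chiM | exact: chi5M | by rewrite /chi /chi5 !qchi1
  | exact: natr_neq0_gt0 | move=> l pl ln].
have [l2|ol] := even_prime pl.
  rewrite l2 chi_2; case: H => [on|->]; last by rewrite /chi5 chi5_2.
  by move: ln; rewrite l2 dvdn2 on.
apply: (@chi_prime_5sqr l y) => //; first exact: coprime_prime_dvd n0.
  rewrite coprime_sym prime_coprime // dvdn_prime2 //.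
  by apply: contraNneq n5 => ->.
by rewrite -(modn_dvdm p ln) py modn_dvdm.
Qed.

Variable r : F.
Hypothesis r2 : r ^+ 2 = 5%:R.

Let n5 : 5%:R != 0 :> F.
Proof. by have := prime_gt1 prp; move=> ?; apply: natr_small_neq0; lia. Qed.
Let r0 : r != 0. Proof. by apply: contraNneq n5 => r0; rewrite -r2 r0 expr0n. Qed.

(** In [F], [x = i r y] up to sign, so [chi r] is the product of [chi i], [chi x] and [chi y]. The
    even coordinate is written [2 z]; its factor 2 cancels [chi i], and if [z] is even too, [p]
    modulo 8 has the value that the divisor 2 requires. *)
Lemma qchi_sqrt5_form5 x y : (p = x ^ 2 + 5 * y ^ 2)%N ->
  qchi r = if odd y then -1 else 1.
Proof.
move=> pE; have p2 := prime_gt1 prp.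
have x0 : (0 < x)%N.
  rewrite lt0n; apply/eqP => x0.
  have d5 : (5 %| p)%N by rewrite pE x0 dvdn_mulr.
  lia.
have y0 : (0 < y)%N.
  by rewrite lt0n; apply/eqP => y0; apply: (@prime_neq_sqr _ x prp); rewrite pE y0 addn0.
have nx0 : x%:R != 0 :> F by apply: natr_small_neq0; nia.
have ny0 : y%:R != 0 :> F by apply: natr_small_neq0; nia.
have irn0 : i != 0 by rewrite expf_neq0 // (prim_root_neq0 pa).
have chix : chi x = qchi i * qchi r * chi y.
  have /eqP : x%:R ^+ 2 = (i * r * y%:R) ^+ 2 :> F.
    apply/eqP; rewrite -subr_eq0 !exprMn i2 r2 mulN1r mulNr opprK.
    by rewrite -!natrX -natrM -natrD -pE card_finField_natr.
  rewrite eqf_sqr => /orP[] /eqP e; rewrite /chi e.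
    by rewrite (qchiM oddF (i * r)) (qchiM oddF i).
  by rewrite (qchiN oddF qN1 (i * r * y%:R)) (qchiM oddF (i * r)) (qchiM oddF i).
have x5 : (x ^ 2 %% 5 = 1)%N by move: p5; rewrite pE addnC mulnC modnMDl.
have chi5x : chi5 x = 1 := chi5_sqr_mod x5.
have xn5 : ~~ (5 %| x)%N by apply/negP => /dvdnP[k xk]; move: x5; rewrite xk -mulnn mulnA modnMl.
have pmodx : p = 5 * y ^ 2 %[mod x] by rewrite pE -mulnn modnMDl.
have pmody : p = x ^ 2 %[mod y] by rewrite pE -mulnn mulnA addnC modnMDl.
have parity : odd x = ~~ odd y.
  by move: oddF; rewrite pE oddD oddM !oddX /=; case: (odd x); case: (odd y).
have chi2i : chi 2 * qchi i = 1 by rewrite -qchiM // qchi_2i.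
case: ifP => [oy|ey].
  (* The sign arises here: [chi r = chi z = chi5 z], where [chi5 (2 z) = chi5 x = 1] but
     [chi5 2 = -1]. *)
  have [z xz] : exists z, x = (2 * z)%N by apply: even_double; rewrite parity oy.
  have chiy : chi y = 1 by apply: chi_sqr_mod pmody _ => //; left.
  have chiz : chi z = qchi r.
    have : chi 2 * chi x = qchi r * (chi 2 * qchi i) * chi y by rewrite chix; ring.
    rewrite chi2i chiy !mulr1 xz chiM mulrA => <-.
    by rewrite /chi qchi_sqr_eq1 ?mul1r // two_neq0.
  rewrite -chiz; have <- : chi5 z = -1.
    by have := chi5x; rewrite xz /chi5 chi5M chi5_2 mulN1r => /eqP; rewrite eqr_oppLR => /eqP.
  apply: (@chi_5sqr_mod z y).
  - by apply: contraNneq nx0 => z0; rewrite xz natrM z0 mulr0.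
  - by apply: contraNN xn5 => /(dvdn_mull 2); rewrite -xz.
  - by rewrite pE xz -[((2 * z) ^ 2)%N]mul1n modn_multiple_sqr.
  - case: (boolP (odd z)) => oz; [by left | right].
    by rewrite pE xz form5_mod8_odd.
have ox : odd x by rewrite parity ey.
have [z yz] : exists z, y = (2 * z)%N by apply: even_double; rewrite ey.
have chix1 : chi x = 1 by rewrite -chi5x; apply: chi_5sqr_mod pmodx _ => //; left.
have chiz : chi z = 1.
  apply: (@chi_sqr_mod z x).
  - by apply: contraNneq ny0 => z0; rewrite yz natrM z0 mulr0.
  - by rewrite pE yz addnC modn_multiple_sqr.
  - case: (boolP (odd z)) => oz; [by left | right].
    by rewrite pE yz form5_mod8_even.
have : chi x = qchi r * (chi 2 * qchi i) * chi z by rewrite chix yz chiM; ring.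
by rewrite chix1 chi2i chiz !mulr1.
Qed.

(** Up to squares, [2 + r] is [2 b (a + 2 b)], and [2 b] is a square because [a] and
    [(a + b)^2 = 2 a b] are. The remaining [a + 2 b] is odd and modulo it [a^2 = 4 b^2], hence
    [p = 5 b^2]. *)
Lemma qchi_theta_form1 a b : (p = a ^ 2 + b ^ 2)%N -> odd a ->
  qchi (2%:R + r) = if (5 %| b)%N then 1 else -1.
Proof.
move=> pE oa; have p2 := prime_gt1 prp.
have a0 : (0 < a)%N by case: a oa {pE}.
have b0 : (0 < b)%N.
  by rewrite lt0n; apply/eqP => b0; apply: (@prime_neq_sqr _ a prp); rewrite pE b0 addn0.
have na0 : a%:R != 0 :> F by apply: natr_small_neq0; nia.
have nb0 : b%:R != 0 :> F by apply: natr_small_neq0; nia.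
have ab : a%:R ^+ 2 = - b%:R ^+ 2 :> F.
  by apply/eqP; rewrite -addr_eq0 -!natrX -natrD -pE card_finField_natr.
have two0 : 2%:R != 0 :> F := two_neq0 oddF.
have chia : chi a = 1.
  by apply: (@chi_sqr_mod a b) => //; [rewrite pE -mulnn modnMDl | left].
have chi2b : chi 2 * chi b = 1.
  have e : (a%:R + b%:R) ^+ 2 = 2%:R * a%:R * b%:R :> F.
    by transitivity (a%:R ^+ 2 + b%:R ^+ 2 + 2%:R * a%:R * b%:R : F); [ring | rewrite ab; ring].
  rewrite -[LHS]mulr1 -chia mulrAC -!qchiM // -e qchi_sqr //.
  by rewrite -sqrf_eq0 e !mulf_neq0.
have n0 : (a + 2 * b)%:R != 0 :> F.
  have : (a + 2 * b)%:R * (2%:R * b%:R - a%:R) = 5%:R * b%:R ^+ 2 :> F.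
    rewrite natrD natrM; transitivity (4%:R * b%:R ^+ 2 - a%:R ^+ 2 : F); [ring | rewrite ab; ring].
  by apply: contra_eq_neq => ->; rewrite mul0r eq_sym mulf_neq0 // expf_neq0.
have r2n0 : 2%:R + r != 0.
  have : (2%:R + r) * (r - 2%:R) = 1 by transitivity (r ^+ 2 - 4%:R); [ring | rewrite r2; ring].
  by apply: contra_eq_neq => ->; rewrite mul0r eq_sym oner_eq0.
have chin : qchi (2%:R + r) = chi (a + 2 * b).
  (* For [theta = 2 + r], the relations [theta^2 - 1 = 4 theta] and [a^2 = - b^2] give
     [(b theta + a)^2 = 2 b (a + 2 b) theta]. *)
  have e : (2%:R * b%:R + a%:R + r * b%:R) ^+ 2 = 2%:R * b%:R * ((a + 2 * b)%:R * (2%:R + r)) :> F.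
    rewrite natrD natrM; transitivity (4%:R * b%:R ^+ 2 + a%:R ^+ 2 + r ^+ 2 * b%:R ^+ 2
      + 4%:R * a%:R * b%:R + 4%:R * r * b%:R ^+ 2 + 2%:R * r * a%:R * b%:R : F); first by ring.
    by rewrite ab r2; ring.
  have : chi 2 * chi b * (chi (a + 2 * b) * qchi (2%:R + r)) = 1.
    by rewrite /chi -!qchiM // -e qchi_sqr // -sqrf_eq0 e !mulf_neq0.
  rewrite chi2b mul1r => H; rewrite -[LHS]mul1r -(qchi_sqr_eq1 n0) -mulrA.
  by rewrite -/(chi _) H mulr1.
have ab5 : ((a ^ 2 + b ^ 2) %% 5 = 1)%N by rewrite -pE.
rewrite chin -(chi5_sum_sqr ab5); apply: (@chi_5sqr_mod _ b) => //.
- exact: sum_sqr_mod5_ndvd.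
- rewrite -(modnMDl (2 * b)) pE (_ : 2 * b * (a + 2 * b) + (a ^ 2 + b ^ 2) =
    a * (a + 2 * b) + 5 * b ^ 2)%N ?modnMDl //; ring.
- by left; rewrite oddD oddM /= addbF.
Qed.
End PrimeField.

(** * Thue's lemma and the representations of [p] *)

Lemma sqrt_floor n : exists k, (k ^ 2 <= n < k.+1 ^ 2)%N.
Proof.
elim: n => [|n [k /andP[k1 k2]]]; first by exists 0%N.
have [H|H] := ltnP n.+1 (k.+1 ^ 2)%N; first by exists k; apply/andP; split=> //; lia.
by exists k.+1; apply/andP; split=> //; nia.
Qed.

Lemma natr_dist_sqr (R : comRingType) a b :
  ((a - b) + (b - a))%:R ^+ 2 = (a%:R - b%:R) ^+ 2 :> R.
Proof.
have [ab|/ltnW ba] := leqP a b.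
  by rewrite (eqP (ab : (a - b)%N == 0%N)) add0n natrB // -[RHS]sqrrN opprB.
by rewrite (eqP (ba : (b - a)%N == 0%N)) addn0 natrB.
Qed.

(** With [K] the integer part of the root of [p], there are more than [p] pairs of integers in
    [[0, K]], so [a - s b] takes a value twice; the differences are at most [K]. A prime is not a
    square, so [K^2 < p] strictly, and this yields [k <= d] instead of [d + 1]. *)
Lemma thue (F : finFieldType) (s : F) (d : nat) : prime #|F| -> (0 < d)%N ->
  s ^+ 2 = - d%:R -> exists x y k, (0 < k <= d)%N /\ (x ^ 2 + d * y ^ 2 = k * #|F|)%N.
Proof.
move=> prp d0 s2; have [K /andP[K1 K2]] := sqrt_floor #|F|.
have {}K1 : (K ^ 2 < #|F|)%N.
  by rewrite ltn_neqAle K1 andbT; apply/eqP => e; apply: (@prime_neq_sqr _ K prp).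
pose f (u : 'I_K.+1 * 'I_K.+1) : F := (u.1 : nat)%:R - s * (u.2 : nat)%:R.
have /injectivePn[[a b] [[a' b'] ne]] : ~~ injectiveb f.
  by apply/injectiveP => /leq_card; rewrite card_prod !card_ord mulnn leqNgt K2.
rewrite /f /= => e.
(* Absolute differences: one of the two truncated subtractions is 0. *)
pose x := ((a - a') + (a' - a))%N; pose y := ((b - b') + (b' - b))%N.
have xK : (x <= K)%N by have := ltn_ord a; have := ltn_ord a'; rewrite /x; lia.
have yK : (y <= K)%N by have := ltn_ord b; have := ltn_ord b'; rewrite /y; lia.
have xy0 : (0 < x ^ 2 + d * y ^ 2)%N.
  rewrite lt0n; apply: contraNneq ne => xy0.
  have x0 : x = 0%N by nia.
  have y0 : y = 0%N by nia.
  rewrite xpair_eqE; apply/andP; split; apply/eqP/val_inj; rewrite /=.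
    by move: x0; rewrite /x; lia.
  by move: y0; rewrite /y; lia.
have N0 : (x ^ 2 + d * y ^ 2)%:R = 0 :> F.
  rewrite natrD natrM !natrX !natr_dist_sqr.
  have -> : (a%:R : F) - a'%:R = s * (b%:R - b'%:R).
    transitivity ((a%:R : F) - s * b%:R - a'%:R + s * b%:R); first by ring.
    by rewrite e; ring.
  by rewrite exprMn s2; ring.
have : (#|F| %| x ^ 2 + d * y ^ 2)%N.
  apply: contraTT isT => nd; have := @natr_coprime_card_neq0 F (x ^ 2 + d * y ^ 2).
  by rewrite N0 eqxx coprime_sym prime_coprime // nd => /(_ isT).
case/dvdnP => k ek; exists x, y, k; split=> //.
have x2 : (x ^ 2 < #|F|)%N by apply: leq_ltn_trans K1; rewrite leq_exp2r.
have y2 : (y ^ 2 < #|F|)%N by apply: leq_ltn_trans K1; rewrite leq_exp2r.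
have : (k * #|F| < d.+1 * #|F|)%N.
  by rewrite -ek mulSn -addSn leq_add // leq_mul // ltnW.
rewrite ltn_mul2r ltnS => /andP[_ ->]; rewrite andbT.
by move: xy0; rewrite ek muln_gt0 => /andP[].
Qed.

Lemma sum_two_squares (F : finFieldType) (i : F) : prime #|F| -> odd #|F| -> i ^+ 2 = -1 ->
  exists a b, (#|F| = a ^ 2 + b ^ 2)%N /\ odd a.
Proof.
move=> prp op i2; have [a [b [k [k1 e]]]] := @thue F i 1 prp isT i2.
have k1' : k = 1%N by lia.
have pE : (#|F| = a ^ 2 + b ^ 2)%N by rewrite k1' in e; lia.
have [oa|ea] := boolP (odd a); first by exists a, b.
exists b, a; split; first by rewrite addnC.
by move: op; rewrite pE oddD !oddX (negbTE ea).
Qed.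

(** Modulo 5 the multiplier [k] is a square, so it is 1, 4 or 5. If it is 4, both coordinates are
    even and are halved; if it is 5, then 5 divides [x], and division by 5 exchanges the roles of
    the coordinates. *)
Lemma prime_form5 (F : finFieldType) (s : F) : prime #|F| -> (#|F| %% 20 = 1)%N ->
  s ^+ 2 = - 5%:R -> exists x y, (#|F| = x ^ 2 + 5 * y ^ 2)%N.
Proof.
move=> prp p20 s2; have [x [y [k [k5 e]]]] := @thue F s 5 prp isT s2.
have x5 : (x ^ 2 %% 5 = k %% 5)%N by move: (y ^ 2)%N e => Y; lia.
have x5' := ltn_pmod x (isT : 0 < 5)%N.
have kE : k = 1%N \/ k = 4%N \/ k = 5%N.
  move: x5; rewrite -modnXm; case: (x %% 5)%N x5' => [|[|[|[|[|]]]]] //= _; lia.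
case: kE => [k1|[k4|k5']].
- by exists x, y; rewrite e k1 mul1n.
- have [] : ~~ odd x /\ ~~ odd y.
    have xy4 : ((x ^ 2 + y ^ 2) %% 4 = 0)%N by move: (x ^ 2)%N (y ^ 2)%N e => X Y; lia.
    exact: sum_sqr_mod4_even.
  move=> /even_double[z xz] /even_double[w yw]; exists z, w.
  apply/eqP; rewrite -(eqn_pmul2l (isT : 0 < 4)%N) -{1}k4 -e xz yw; apply/eqP; ring.
have dx : (5 %| x)%N.
  by move: x5; rewrite k5' -modnXm; rewrite /dvdn; case: (x %% 5)%N x5' => [|[|[|[|[|]]]]].
have [z xz] := dvdnP dx; exists y, z.
apply/eqP; rewrite -(eqn_pmul2l (isT : 0 < 5)%N) -{1}k5' -e xz; apply/eqP; ring.
Qed.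

(** Through [20 = 5 2^2] and [100 = 1 10^2], the two forms become [x^2 + 5 y^2] with [y] even and
    [x^2 + y^2] with [y] divisible by 10. *)
Lemma sqr_int_nat (q a b : nat) :
  (exists x y : int, (q%:Z = x ^+ 2 + (a * b ^ 2)%:Z * y ^+ 2)%R) <->
  exists x y : nat, (q = x ^ 2 + a * (b * y) ^ 2)%N.
Proof.
have nE x y : (q%:Z = x ^+ 2 + (a * b ^ 2)%:Z * y ^+ 2)%R <-> (q = `|x| ^ 2 + a * (b * `|y|) ^ 2)%N.
  have sq (z : int) : z ^+ 2 = (`|z| ^ 2)%N%:Z by case: z => n; lia.
  have -> : (x ^+ 2 + (a * b ^ 2)%:Z * y ^+ 2)%R = (`|x| ^ 2 + a * (b * `|y|) ^ 2)%N%:Z.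
    by rewrite !sq -PoszM -PoszD expnMn mulnA.
  by split=> [[]|->].
split=> [[x [y /nE e]]|[x [y e]]]; first by exists `|x|%N, `|y|%N.
by exists x%:Z, y%:Z; apply/nE.
Qed.

Theorem theorem4p1 (F : finFieldType) (alpha : F) :
  (#|F| %% 20 = 1)%N ->
  (#|F|.-1).-primitive_root alpha ->
  let q := #|F| in
  let beta := alpha ^+ ((q.-1) %/ 5) in
  [/\ gives_3design F 5 <-> gives_3design F 10,
      gives_3design F 5 <-> qchi (1 + beta) = -1,
      gives_3design F 5 <->
        (exists theta : F, [/\ theta != 0, qchi theta = -1 &
                               theta ^+ 2 - 4%:R * theta - 1 = 0]),
      gives_3design F 5 <-> ~ (exists n : nat, (alpha ^+ 4) ^+ n = 5%:R)
    & prime q ->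
      (gives_3design F 5 <->
         ~ (exists x y : int, (q%:Z = x ^+ 2 + 20 * y ^+ 2)%R))
      /\ (gives_3design F 5 <->
         ~ (exists x y : int, (q%:Z = x ^+ 2 + 100 * y ^+ 2)%R))].
Proof.
move=> q20 pa q beta.
have q0 := prim_order_gt0 pa.
have q1 : (4 %| #|F|.-1)%N by lia.
have d5 : (5 %| #|F|.-1)%N by lia.
have d10 : (10 %| #|F|.-1)%N by lia.
have oddF := odd_of_dvd4 q1 pa.
have qN1 := qchi_m1 q1 pa.
have pb : 5.-primitive_root beta := dvdn_prim_root pa d5.
have pc : 10.-primitive_root (alpha ^+ (#|F|.-1 %/ 10)) := dvdn_prim_root pa d10.
have even_exp n : ~~ odd n -> qchi (alpha ^+ n) = 1.
  by move=> en; rewrite (qchi_prim_root oddF _ pa) -signr_odd (negbTE en).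
have qb : qchi beta = 1 by apply: even_exp; rewrite /q; lia.
have qc : qchi (alpha ^+ (#|F|.-1 %/ 10)) = 1 by apply: even_exp; lia.
have cb : (alpha ^+ (#|F|.-1 %/ 10)) ^+ 2 = beta by rewrite -exprM; congr (_ ^+ _); rewrite /q; lia.
have h5 : gives_3design F 5 <-> qchi (1 + beta) = -1.
  rewrite /gives_3design /root_subgroup starter3P ?(card_root_set pb) //.
  exact: charsum_fifth_roots.
have h10 : gives_3design F 10 <-> qchi (1 + beta) = -1.
  rewrite /gives_3design /root_subgroup starter3P ?(card_root_set pc) //.
  exact: (charsum_tenth_roots oddF qN1 pb qb pc).
have n5 : 5%:R != 0 :> F.
  by apply: natr_coprime_card_neq0; rewrite prime_coprime //; lia.
split=> //.
- by rewrite h5 h10.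
- by rewrite h5; apply: theta_nonsquareP.
- by rewrite h5; apply: fourth_power_five.
move=> prq.
have i2 := sqr_prim_root_quarter q1 pa.
have r2 := sqr_sqrt5 pb.
have v1 := fifth_1Db_neq0 pb.
have q20' : (q %% 20 = 1)%N := q20.
have qr : qchi (sqrt5 beta) = qchi (1 + beta) by apply: qchi_sqrt5.
have qth : qchi (2%:R + sqrt5 beta) = qchi (1 + beta).
  apply: qchi_theta => //.
  by transitivity (sqrt5 beta ^+ 2 - 5%:R); [ring | rewrite r2 subrr].
have e20 : (exists x y : int, (q%:Z = x ^+ 2 + 20 * y ^+ 2)%R) <->
  exists x y : nat, (q = x ^ 2 + 5 * (2 * y) ^ 2)%N := sqr_int_nat q 5 2.
have e100 : (exists x y : int, (q%:Z = x ^+ 2 + 100 * y ^+ 2)%R) <->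
  exists x y : nat, (q = x ^ 2 + 1 * (10 * y) ^ 2)%N := sqr_int_nat q 1 10.
rewrite h5 e20 e100; split; split.
- move=> v [x [y e]]; have := qchi_sqrt5_form5 prq q20 pa r2 e.
  by rewrite qr v oddM.
- move=> H; case: (qchi_pm1 v1) => // v; case: H.
  have [|x [y e]] := @prime_form5 F (alpha ^+ (#|F|.-1 %/ 4) * sqrt5 beta) prq q20.
    by rewrite exprMn i2 r2 mulN1r.
  have := qchi_sqrt5_form5 prq q20 pa r2 e; rewrite qr v; case: ifP => // ey _.
  by exists x, y./2; rewrite /q e; congr (_ + 5 * _ ^ 2)%N; lia.
- move=> v [x [y e]]; rewrite mul1n in e.
  have ox : odd x by move: oddF; rewrite -/q e oddD !oddX oddM /= addbF.
  have := qchi_theta_form1 prq q20 pa r2 e ox.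
  by rewrite qth v (_ : 5 %| 10 * y)%N //; lia.
- move=> H; case: (qchi_pm1 v1) => // v; case: H.
  have [a [b [e oa]]] := sum_two_squares prq oddF i2.
  have := qchi_theta_form1 prq q20 pa r2 e oa; rewrite qth v; case: ifP => // b5 _.
  (* Divisibility of [b] by 5 comes from the character and by 2 from the parity of [a], so 10
     divides [b]. *)
  have eb : ~~ odd b by move: oddF; rewrite e oddD !oddX oa; case: (odd b).
  by exists a, (b %/ 10)%N; rewrite /q e mul1n; congr (_ + _ ^ 2)%N; lia.
Qed.
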